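(* The configuration $\Pi_{\mathfrak m}$ of six open solid cylinders of radius $r_{\mathfrak m}=\frac18(3+\sqrt{33})$ associated with $C_{\mathfrak m}$ cannot be unlocked and, moreover, it is rigid.
   Context: Let $\mathbb S^2\subset\mathbb R^3$ be the unit sphere centered at the origin. A line tangent to $\mathbb S^2$ is given by a pair $u=(x,\xi)$, with $x\in\mathbb S^2$ the tangency point and $\xi$ a unit tangent vector at $x$ (defined up to sign). For $r>0$ let $\mathrm C_u(r)$ be the infinite open solid circular cylinder of radius $r$ whose axis is the line through $(1+r)x$ with direction $\xi$; it touches the unit ball at $x$ from outside. Coordinates: a point of $\mathbb S^2$ is written $(\varphi,\varkappa)$ with latitude $\varphi$ and longitude $\varkappa$ (modulo $2\pi$), i.e. it is $(\cos\varphi\cos\varkappa,\cos\varphi\sin\varkappa,\sin\varphi)$. For $x\in\mathbb S^2$ different from the poles, $[x,\uparrow_\delta]$ denotes the tangent line at $x$ whose direction is obtained from the unit tangent vector at $x$ pointing North by the rotation by the angle $\delta$ about the axis from the origin to $x$, counterclockwise when viewed from the tip of $x$. $C_{\mathfrak m}$ is the configuration of six tangent lines $$A=[(\varphi,\tfrac{\pi}{6}-\varkappa),\uparrow_\delta],\quad B=[(\varphi,\tfrac{5\pi}{6}-\varkappa),\uparrow_\delta],\quad C=[(\varphi,\tfrac{3\pi}{2}-\varkappa),\uparrow_\delta],$$ $$D=[(-\varphi,\tfrac{\pi}{2}+\varkappa),\uparrow_\delta],\quad E=[(-\varphi,\tfrac{7\pi}{6}+\varkappa),\uparrow_\delta],\quad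 F=[(-\varphi,\tfrac{11\pi}{6}+\varkappa),\uparrow_\delta]$$ with $\varphi=\arcsin\sqrt{3/11}$, $\delta=\arctan\sqrt{5/11}$, $\varkappa=-\arctan(1/\sqrt{15})$, and $\Pi_{\mathfrak m}=\{\mathrm C_u(r_{\mathfrak m}) : u\in\{A,B,C,D,E,F\}\}$. Let $\Pi=\{\Lambda_1,\dots,\Lambda_k\}$ be a collection of pairwise non-intersecting open solid bodies, each touching the unit central ball (i.e. disjoint from the open unit ball, with closure meeting the closed unit ball), some of the distances between bodies of $\Pi$ being zero. A continuous deformation of $\Pi$ is a family $\Pi(t)=\{\Lambda_1(t),\dots,\Lambda_k(t)\}$, $t\ge0$, of collections of pairwise non-intersecting open solid bodies, each touching the unit central ball, such that $\Lambda_j(t)=g_j(t)\Lambda_j$, $j=1,\dots,k$, where $g_j(t)$ is a continuous curve in the group of Euclidean motions of $\mathbb R^3$ with $g_j(0)=\mathrm{Id}$. $\Pi$ can be unlocked if there is a continuous deformation $\Pi(t)$ of $\Pi$ such that some of the zero distances between the members of $\Pi$ are positive in $\Pi(t)$ for all $t>0$. $\Pi$ is rigid if its only continuous deformations are global rotations, i.e. for each continuous deformation $\Pi(t)$ and each $t\ge 0$ there is $g(t)\in SO(3)$ with $\Lambda_j(t)=g(t)\Lambda_j$ (as sets) for all $j$.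
   Formalization: With the rotation by δ counterclockwise as stated, cylinders A and D intersect, so Π_m is not a collection and the claim is vacuous; the theorem also treats the clockwise rotation, for which Π_m is shown to be a touching collection with contacts, rigid and not unlockable. *)

(* Defs.v *)
From HB Require Import structures.
From mathcomp Require Import all_boot all_order all_algebra.
From mathcomp Require Import all_classical all_reals all_analysis.

Set Implicit Arguments.
Unset Strict Implicit.
Unset Printing Implicit Defensive.

Import Order.TTheory GRing.Theory Num.Theory.
Import numFieldNormedType.Exports.

Local Open Scope classical_set_scope.
Local Open Scope ring_scope.

Section Space.
Variable R : realType.
Implicit Types (u v x : 'cV[R]_3) (L M : set 'cV[R]_3).

Definition vec3 (a b c : R) : 'cV[R]_3 := \col_(i < 3) [:: a; b; c]`_i.

Definition dot u v : R := \sum_i u i 0 * v i 0.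

(* The library norm on matrices is the sup norm; it gives the right topology
   but not the Euclidean metric. *)
Definition enorm u : R := Num.sqrt (dot u u).

Definition cross u v : 'cV[R]_3 :=
  vec3 (u 1 0 * v 2 0 - u 2 0 * v 1 0)
       (u 2 0 * v 0 0 - u 0 0 * v 2 0)
       (u 0 0 * v 1 0 - u 1 0 * v 0 0).

(* Rodrigues' formula: for a unit vector x, the rotation of v by the angle a
   about x, counterclockwise when viewed from the tip of x. *)
Definition rotate x (a : R) v : 'cV[R]_3 :=
  cos a *: v + sin a *: cross x v + ((1 - cos a) * dot x v) *: x.

Definition set_dist L M : R := inf [set enorm (p - q) | p in L & q in M].

Definition open_ball : set 'cV[R]_3 := [set p | enorm p < 1].
Definition closed_ball : set 'cV[R]_3 := [set p | enorm p <= 1].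

Definition touches_ball L : Prop :=
  L `&` open_ball = set0 /\ closure L `&` closed_ball !=set0.

Definition orthogonal_mx (A : 'M[R]_3) : Prop := A^T *m A = 1%:M.

Definition SO3 (A : 'M[R]_3) : Prop := orthogonal_mx A /\ \det A = 1.

End Space.

Arguments open_ball {R}.
Arguments closed_ball {R}.

Section Collections.
Variables (R : realType) (k : nat).

(* Collections are indexed families, so that bodies keep their labels. *)
Definition collection : Type := 'I_k -> set 'cV[R]_3.

Implicit Types (P : collection) (Pt : R -> collection).

Definition touching_collection P : Prop :=
  [/\ forall j, open (P j),
      forall i j, i != j -> P i `&` P j = set0
    & forall j, touches_ball (P j)].

Definition has_contact P : Prop :=
  exists i j, i != j /\ set_dist (P i) (P j) = 0.

(* The curve of Euclidean motions is g_j(t) p = A j t *m p + b j t.  Only the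
   values of Pt at times t >= 0 matter. *)
Definition deformation P Pt : Prop :=
  (forall t, 0 <= t -> touching_collection (Pt t)) /\
  exists (A : 'I_k -> R -> 'M[R]_3) (b : 'I_k -> R -> 'cV[R]_3),
    forall j,
      [/\ {within `[0, +oo[, continuous (A j)},
          {within `[0, +oo[, continuous (b j)},
          forall t, 0 <= t -> orthogonal_mx (A j t),
          A j 0 = 1%:M /\ b j 0 = 0
        & forall t, 0 <= t -> Pt t j = [set A j t *m p + b j t | p in P j]].

Definition can_be_unlocked P : Prop :=
  exists Pt, deformation P Pt /\
    exists i j, [/\ i != j, set_dist (P i) (P j) = 0
      & forall t, 0 < t -> 0 < set_dist (Pt t i) (Pt t j)].

Definition rigid P : Prop :=
  forall Pt, deformation P Pt -> forall t, 0 <= t ->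
    exists2 g : 'M[R]_3, SO3 g & forall j, Pt t j = [set g *m p | p in P j].

End Collections.

Section Cylinders.
Variable R : realType.

(* A tangent line: the tangency point and a unit tangent direction there. *)
Definition tangent_line : Type := 'cV[R]_3 * 'cV[R]_3.

Definition cylinder (u : tangent_line) (r : R) : set 'cV[R]_3 :=
  [set p | exists s : R, enorm (p - ((1 + r) *: u.1 + s *: u.2)) < r].

Definition sphere_point (lat lon : R) : 'cV[R]_3 :=
  vec3 (cos lat * cos lon) (cos lat * sin lon) (sin lat).

(* Derivative of sphere_point in the latitude; the unit tangent vector
   pointing North when |lat| < pi / 2. *)
Definition north (lat lon : R) : 'cV[R]_3 :=
  vec3 (- (sin lat * cos lon)) (- (sin lat * sin lon)) (cos lat).

(* The tangent line [x, uparrow_delta].  The flag cw selects the sense of the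
   rotation viewed from the tip of x: counterclockwise for cw = false,
   clockwise for cw = true. *)
Definition up_line (cw : bool) (lat lon delta : R) : tangent_line :=
  let x := sphere_point lat lon in
  (x, rotate x ((-1) ^+ cw * delta) (north lat lon)).

Definition phi_m : R := asin (Num.sqrt (3 / 11)).
Definition delta_m : R := atan (Num.sqrt (5 / 11)).
Definition kappa_m : R := - atan (1 / Num.sqrt 15).
Definition r_m : R := (3 + Num.sqrt 33) / 8.

(* With these phi, delta and kappa the counterclockwise convention fails: the
   cylinders at A and D intersect for cw = false, whereas all six cylinders of
   radius r_m are pairwise disjoint for cw = true.  Reflection in a meridian
   plane reverses the signs of both delta and kappa, so correcting the sign of
   kappa instead of the sense of rotation gives a mirror image of the case
   cw = true. *)
Definition C_m (cw : bool) : 6.-tuple tangent_line :=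
  [tuple up_line cw phi_m (pi / 6 - kappa_m) delta_m;
         up_line cw phi_m (5 * pi / 6 - kappa_m) delta_m;
         up_line cw phi_m (3 * pi / 2 - kappa_m) delta_m;
         up_line cw (- phi_m) (pi / 2 + kappa_m) delta_m;
         up_line cw (- phi_m) (7 * pi / 6 + kappa_m) delta_m;
         up_line cw (- phi_m) (11 * pi / 6 + kappa_m) delta_m].

Definition Pi_m (cw : bool) : collection R 6 :=
  fun j => cylinder (tnth (C_m cw) j) r_m.

End Cylinders.

Arguments Pi_m R cw : clear implicits.

(* Main.v *)
Require Import Defs.
From mathcomp Require Import all_boot all_order all_algebra.
From mathcomp Require Import all_classical all_reals all_analysis.
From mathcomp Require Import ring lra.

(* A cylinder touching the unit ball is determined by the direction xi of its axis
   and n = x cross xi, and two cylinders of radius r_m are disjoint iff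
   11/12 (xi . n' + xi' . n)^2 + (xi . xi')^2 >= 1. For C_m equality holds for
   twelve of the fifteen pairs. The twelve differentials satisfy exactly one linear
   relation, and its coefficients are positive. Along a deformation, after a rotation
   that fixes line A, the weighted sum of the twelve clearances is nonnegative and
   of second order, so every differential is of second order as well; hence the
   displacement agrees, up to second order, with its projection to the
   4-dimensional common kernel of the differentials. There the second-order form of
   the weighted sum is negative definite, which forces small displacements to
   vanish. By continuity of the total displacement and the intermediate value
   theorem it vanishes at all times, so the deformation is a global rotation.

   For the counterclockwise convention the cylinders at A and D overlap, so that
   there is no deformation at all. *)

Set Implicit Arguments.
Unset Strict Implicit.
Unset Printing Implicit Defensive.

Import Order.TTheory GRing.Theory Num.Theory.
Import numFieldNormedType.Exports.

Local Open Scope classical_set_scope.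
Local Open Scope ring_scope.


(** * Second-order expansions *)

(** The motions are merely continuous, so nothing can be differentiated in time and no leading term
    of a motion can be extracted. All estimates are therefore pointwise, with constants uniform over
    all times at which the deviation is at most 1, and the outcome is a gap: some eps > 0 such that
    the deviation never lies strictly between 0 and eps. First-order rigidity fails: five free lines
    with three degrees of freedom each give 15 unknowns, while twelve differentials with one
    relation have rank 11. The part of the displacement outside the kernel is known only to be of
    second order, but up to cubic terms it enters the weighted sum through the differentials alone,
    and there the linear relation cancels it. With nu the deviation and zeta the size of the kernel
    coordinates, this yields zeta^2 <= C nu^3 and nu <= K (zeta + nu^2), which are incompatible for
    small nu > 0. *)

Section BigO.
Variables (R : realFieldType) (T : Type) (D : T -> Prop) (nu : T -> R).
Hypothesis nu01 : forall t, D t -> 0 <= nu t <= 1.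
Implicit Types (f g l q : T -> R) (c : R) (k m : nat).

(** No limit is involved: [T] carries no topology, and one constant serves for all of [D]. The size
    function [nu] is a parameter because [deviation_zeta] measures orders against a second one. *)
Definition isbigO k f : Prop :=
  exists2 C : R, 0 <= C & forall t, D t -> `|f t| <= C * nu t ^+ k.
Local Notation bigO := isbigO.

Lemma eq_bigO k f g : (forall t, D t -> f t = g t) -> bigO k f -> bigO k g.
Proof. by move=> fg [C C0 Cf]; exists C => // t Dt; rewrite -fg// Cf. Qed.

Lemma bigOW k m f : (k <= m)%N -> bigO m f -> bigO k f.
Proof.
move=> km [C C0 Cf]; exists C => // t Dt; apply: le_trans (Cf t Dt) _.
rewrite ler_wpM2l//; have /andP[n0 n1] := nu01 Dt.
exact: ler_wiXn2l.
Qed.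

Lemma bigOD k f g : bigO k f -> bigO k g -> bigO k (fun t => f t + g t).
Proof.
move=> [C C0 Cf] [C' C'0 Cg]; exists (C + C'); first exact: addr_ge0.
by move=> t Dt; rewrite mulrDl (le_trans (ler_normD _ _))// lerD ?Cf ?Cg.
Qed.

Lemma bigOM k m f g : bigO k f -> bigO m g -> bigO (k + m) (fun t => f t * g t).
Proof.
move=> [C C0 Cf] [C' C'0 Cg]; exists (C * C'); first exact: mulr_ge0.
by move=> t Dt; rewrite normrM exprD mulrACA ler_pM ?Cf ?Cg.
Qed.

Lemma bigO_cst c : bigO 0 (fun=> c).
Proof. by exists `|c| => // t _; rewrite expr0 mulr1. Qed.

Lemma bigO0 k : bigO k (fun=> 0).
Proof. by exists 0 => // t _; rewrite normr0 mul0r. Qed.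

Lemma bigOZ k c f : bigO k f -> bigO k (fun t => c * f t).
Proof. by move=> Of; have := bigOM (bigO_cst c) Of; rewrite add0n. Qed.

Lemma bigON k f : bigO k f -> bigO k (fun t => - f t).
Proof. by move=> [C C0 Cf]; exists C => // t Dt; rewrite normrN Cf. Qed.

Lemma bigOB k f g : bigO k f -> bigO k g -> bigO k (fun t => f t - g t).
Proof. by move=> Of Og; apply: bigOD => //; apply: bigON. Qed.

Lemma bigO_sum k (I : Type) (r : seq I) (F : I -> T -> R) :
  (forall i, bigO k (F i)) -> bigO k (fun t => \sum_(i <- r) F i t).
Proof.
move=> OF; elim: r => [|i r IHr].
  by apply: eq_bigO (bigO0 k) => t _; rewrite big_nil.
by apply: eq_bigO (bigOD (OF i) IHr) => t _; rewrite big_cons.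
Qed.

(* [jet f c l q]: second-order expansion of [f] around a point where [nu]
   vanishes, with constant, linear and quadratic parts [c], [l] and [q]. *)
Definition jet f c l q : Prop :=
  [/\ bigO 1 l, bigO 2 q & bigO 3 (fun t => f t - (c + l t + q t))].

Lemma eq_jet f c l q f' c' l' q' : jet f c l q ->
  (forall t, D t -> f t = f' t) -> c = c' -> (forall t, D t -> l t = l' t) ->
  (forall t, D t -> q t = q' t) -> jet f' c' l' q'.
Proof.
move=> [Ol Oq Of] ff <- ll qq; split.
- exact: eq_bigO Ol.
- exact: eq_bigO Oq.
- by apply: eq_bigO Of => t Dt; rewrite ff// ll// qq.
Qed.

Lemma jet_bigO0 f c l q : jet f c l q -> bigO 0 f.
Proof.
move=> [Ol Oq Of].
apply: (@eq_bigO _ (fun t => (f t - (c + l t + q t)) + (c + l t + q t))) => [t _|].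
  by rewrite subrK.
apply: (bigOD (bigOW _ Of)) => //.
exact: bigOD (bigOD (bigO_cst c) (bigOW _ Ol)) (bigOW _ Oq).
Qed.

Lemma jet_bigO2 f l q : jet f 0 l q -> bigO 2 (fun t => f t - l t).
Proof.
move=> [_ Oq Of].
apply: (@eq_bigO _ (fun t => (f t - (0 + l t + q t)) + q t)) => [t _|].
  by ring.
by apply: bigOD => //; exact: bigOW Of.
Qed.

Lemma jet_cst c : jet (fun=> c) c (fun=> 0) (fun=> 0).
Proof.
split; [exact: bigO0|exact: bigO0|].
by apply: eq_bigO (bigO0 3) => t _; rewrite !addr0 subrr.
Qed.

Lemma jetD f c l q f' c' l' q' : jet f c l q -> jet f' c' l' q' ->
  jet (fun t => f t + f' t) (c + c') (fun t => l t + l' t) (fun t => q t + q' t).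
Proof.
move=> [Ol Oq Of] [Ol' Oq' Of']; split; [exact: bigOD|exact: bigOD|].
by apply: eq_bigO (bigOD Of Of') => t _; ring.
Qed.

Lemma jetM f c l q f' c' l' q' : jet f c l q -> jet f' c' l' q' ->
  jet (fun t => f t * f' t) (c * c') (fun t => l t * c' + c * l' t)
      (fun t => q t * c' + l t * l' t + c * q' t).
Proof.
move=> Jf Jg; have [Of0 Og0] := (jet_bigO0 Jf, jet_bigO0 Jg).
move: Jf Jg => [Ol Oq Of] [Ol' Oq' Of'].
have Zr k h a : bigO k h -> bigO k (fun t => h t * a).
  by move=> Oh; apply: eq_bigO (bigOZ a Oh) => t _; rewrite mulrC.
split.
- by apply: bigOD; [exact: Zr|exact: bigOZ].
- by apply: bigOD; [apply: bigOD; [exact: Zr|exact: (bigOM Ol Ol')]|exact: bigOZ].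
(* Telescoping of the two remainders, plus the products of degree at least three that the truncation
   drops. *)
apply: (@eq_bigO _ (fun t => (f t - (c + l t + q t)) * f' t
   + (c + l t + q t) * (f' t - (c' + l' t + q' t))
   + (l t * q' t + q t * (l' t + q' t)))) => [t _|]; first by ring.
apply: bigOD; [apply: bigOD|apply: bigOD].
- exact: (bigOM Of Og0).
- apply: (@bigOM 0 3) => //.
  exact: bigOD (bigOD (bigO_cst c) (bigOW _ Ol)) (bigOW _ Oq).
- exact: (bigOM Ol Oq').
- by apply: (bigOM Oq); apply: bigOD => //; exact: bigOW Oq'.
Qed.

Lemma jetZ a f c l q : jet f c l q ->
  jet (fun t => a * f t) (a * c) (fun t => a * l t) (fun t => a * q t).
Proof.
by move=> Jf; apply: (eq_jet (jetM (jet_cst a) Jf)) => // t _; rewrite !mul0r ?add0r.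
Qed.

End BigO.

(** * The six lines over Q(sqrt 5) *)

Section Lines.
Variable R : realFieldType.

(* Coordinates with scales 1, sqrt 3 and sqrt 6 along the three axes: in them all
   data of the configuration lie in Q(sqrt 5), and [wdot] is the dot product. *)
Record vec := Vec {v1 : R; v2 : R; v3 : R}.

Definition vadd (a b : vec) : vec := Vec (v1 a + v1 b) (v2 a + v2 b) (v3 a + v3 b).
Definition vscale (k : R) (a : vec) : vec := Vec (k * v1 a) (k * v2 a) (k * v3 a).

Definition wdot (a b : vec) : R := v1 a * v1 b + 3 * (v2 a * v2 b) + 6 * (v3 a * v3 b).

(* A line with unit direction xi and tangency point x is stored as
   [ldir] = 24 xi / sqrt 3 and [lnor] = 48 sqrt (11 / 12) (x cross xi). With this
   scaling [ldot] and [sqrt 3 * lmom] are 1152 times xi . xi' and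
   sqrt (11 / 12) (xi . (x' cross xi') + xi' . (x cross xi)), and two cylinders of
   radius r_m are disjoint iff [clearance] is at least 1152 ^+ 2, because
   ((1 + r_m) / (2 r_m)) ^+ 2 = 11 / 12. *)
Record line := Line {ldir : vec; lnor : vec}.

Definition ladd (a b : line) : line :=
  Line (vadd (ldir a) (ldir b)) (vadd (lnor a) (lnor b)).

Definition ldot (a b : line) : R := 6 * wdot (ldir a) (ldir b).
Definition lmom (a b : line) : R := wdot (ldir a) (lnor b) + wdot (lnor a) (ldir b).
Definition clearance (a b : line) : R := ldot a b ^+ 2 + 3 * lmom a b ^+ 2.

(* [fpt] is sqrt 88 times the tangency point. *)
Record frame := Frame {fpt : vec; faxis : line}.
(** Up to scale, the parameters of an infinitesimal rotation of a frame about its normal, its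
    tangency point and its axis direction, in this order. *)
Record tilt := Tilt {cu : R; cw : R; cp : R}.

Definition csub (a b : tilt) : tilt :=
  Tilt (cu a - cu b) (cw a - cw b) (cp a - cp b).

(** Expansion of a moved direction and normal in the orthogonal frame of point, direction and
    normal. [e] and [f] are the losses along the original vectors; the numerical factors absorb the
    different scalings and keep later coefficients rational. *)
Definition perturb (F : frame) (u w p g e f : R) : line :=
  let: Frame x (Line X m) := F in
  Line (vadd (vscale (1 - e) X) (vadd (vscale (12 * u) x) (vscale (2 * w) m)))
       (vadd (vscale (1 - f) m) (vadd (vscale (24 * p) x) (vscale (- (22 * g)) X))).

(* First- and second-order parts of [perturb] once e, f and g are eliminated
   through the constraints that the direction and normal are orthonormal. *)
Definition perturb1 (F : frame) (a : tilt) : line :=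
  let: Frame x (Line X m) := F in
  Line (vadd (vscale (12 * cu a) x) (vscale (2 * cw a) m))
       (vadd (vscale (24 * cp a) x) (vscale (- (22 * cw a)) X)).

Definition perturb2 (F : frame) (a : tilt) : line :=
  let: Frame x (Line X m) := F in
  Line (vscale (- (33 * cu a ^+ 2 + 22 * cw a ^+ 2)) X)
       (vadd (vscale (- (12 * cp a ^+ 2 + 22 * cw a ^+ 2)) m)
             (vscale (- (132 * (cu a * cp a))) X)).

(** Half the differential of [clearance]: the factor 2 from the squares is restored in
    [jet_clear]. *)
Definition clearance1 (F G : frame) (a b : tilt) : R :=
  ldot (faxis F) (faxis G) *
    (ldot (perturb1 F a) (faxis G) + ldot (faxis F) (perturb1 G b)) +
  3 * (lmom (faxis F) (faxis G) *
    (lmom (perturb1 F a) (faxis G) + lmom (faxis F) (perturb1 G b))).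

Definition clearance2 (F G : frame) (a b : tilt) : R :=
  2 * (ldot (faxis F) (faxis G) *
    (ldot (perturb2 F a) (faxis G) + ldot (perturb1 F a) (perturb1 G b) +
     ldot (faxis F) (perturb2 G b)) +
  3 * (lmom (faxis F) (faxis G) *
    (lmom (perturb2 F a) (faxis G) + lmom (perturb1 F a) (perturb1 G b) +
     lmom (faxis F) (perturb2 G b)))) +
  (ldot (perturb1 F a) (faxis G) + ldot (faxis F) (perturb1 G b)) ^+ 2 +
  3 * (lmom (perturb1 F a) (faxis G) + lmom (faxis F) (perturb1 G b)) ^+ 2.

(* Twice the rotation by 0, 120 or 240 degrees about the third axis. *)
Definition vturn (i : nat) (a : vec) : vec :=
  match i with
  | 0 => Vec (2 * v1 a) (2 * v2 a) (2 * v3 a)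
  | 1 => Vec (- (v1 a + 3 * v2 a)) (v1 a - v2 a) (2 * v3 a)
  | _ => Vec (3 * v2 a - v1 a) (- (v1 a + v2 a)) (2 * v3 a)
  end.
Definition turn (i : nat) (F : frame) : frame :=
  let: Frame x (Line X m) := F in
  Frame (vturn i x) (Line (vturn i X) (vturn i m)).

Variable s5 : R.
Hypothesis s5E : s5 ^+ 2 = 5.

Definition frameC : frame := Frame (Vec 1 (- s5) 1)
  (Line (Vec 3 s5 2) (Vec (- (9 * s5)) 1 (2 * s5))).
(** The half-turn of [frameC] about the first axis, with direction and hence normal reversed.
    Together with [turn] it generates the D3 symmetry. *)
Definition frameD : frame := Frame (Vec 1 s5 (- 1))
  (Line (Vec (- 3) s5 2) (Vec (9 * s5) 1 (2 * s5))).

Definition base_frame (i : nat) : frame :=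
  match i with
  | 0 => turn 1 frameC
  | 1 => turn 2 frameC
  | 2 => turn 0 frameC
  | 3 => turn 0 frameD
  | 4 => turn 1 frameD
  | _ => turn 2 frameD
  end.

(* Lines A, ..., F are numbered 0, ..., 5; the pairs AE, BF and CD are not in
   contact. *)
Definition contact (k : nat) : nat * nat :=
  nth (0, 0)%N [:: (0, 1); (0, 2); (1, 2); (3, 4); (3, 5); (4, 5);
    (0, 3); (1, 4); (2, 5); (1, 3); (2, 4); (0, 5)]%N k.

(* Up to scaling, the only linear dependency among the differentials of the
   twelve contact clearances. *)
Definition stress (k : nat) : R :=
  nth 0 [:: 1; 1; 1; 1; 1; 1; 6 + 2 * s5; 6 + 2 * s5; 6 + 2 * s5;
    6 - 2 * s5; 6 - 2 * s5; 6 - 2 * s5] k.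

(* Locked, as the unary numeral 1152 must not be unfolded. *)
Definition level : R := locked (1152 ^+ 2).
Lemma levelE : level = 1152 ^+ 2. Proof. by rewrite /level -lock. Qed.

Definition cclearance (a : nat -> line) (k : nat) : R :=
  clearance (a (contact k).1) (a (contact k).2).
Definition cclearance1 (v : nat -> tilt) (k : nat) : R :=
  clearance1 (base_frame (contact k).1) (base_frame (contact k).2)
    (v (contact k).1) (v (contact k).2).
Definition cclearance2 (v : nat -> tilt) (k : nat) : R :=
  clearance2 (base_frame (contact k).1) (base_frame (contact k).2)
    (v (contact k).1) (v (contact k).2).

(* With A fixed, the differentials of the contact clearances have a common kernel
   of dimension 4. This basis of it is adapted to the D3 symmetry of the
   configuration, so that it diagonalizes the second-order form. *)
Definition kernel_vec (z1 z2 z3 z4 : R) (i : nat) : tilt :=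
  match i with
  | 1 => Tilt
      ((42 + 30 * s5) * z1 + (- 14 - 10 * s5) * z2 + (30 - 6 * s5) * z3 + (-
        38 - 18 * s5) * z4)
      ((108 - 12 * s5) * z1 + (- 36 + 4 * s5) * z2 + (- 180 - 84 * s5) * z3 +
        (- 12 + 36 * s5) * z4)
      ((- 33 + 33 * s5) * z1 + (11 - 11 * s5) * z2 + (165 - 165 * s5) * z3 +
        (- 33 + 33 * s5) * z4)
  | 2 => Tilt
      ((- 42 + 30 * s5) * z1 + (14 - 10 * s5) * z2 + (150 - 54 * s5) * z3 + (-
        22 + 6 * s5) * z4)
      ((108 + 12 * s5) * z1 + (- 36 - 4 * s5) * z2 + (360 - 24 * s5) * z3 + 48
        * z4)
      ((- 33 - 33 * s5) * z1 + (11 + 11 * s5) * z2 + (165 - 33 * s5) * z3 +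
        (99 + 33 * s5) * z4)
  | 3 => Tilt
      ((48 - 32 * s5) * z1 + (- 16 - 4 * s5) * z2 + (- 30 - 2 * s5) * z3 + (-
        22 - 66 * s5) * z4)
      ((36 - 24 * s5) * z1 + (32 + 8 * s5) * z2 + (720 + 48 * s5) * z3 + 0 *
        z4)
      (0 * z1 + 22 * z2 + (495 - 99 * s5) * z3 + (- 33 + 33 * s5) * z4)
  | 4 => Tilt
      ((- (8 * s5)) * z1 + (- (12 * s5)) * z2 + (- 270 - 26 * s5) * z3 + (- 26
        + 18 * s5) * z4)
      (108 * z1 + 8 * z2 + (- 540 + 36 * s5) * z3 + (- 12 - 108 * s5) * z4)
      (132 * z1 + (- 22) * z2 + (- 165 - 99 * s5) * z3 + (33 - 33 * s5) * z4)
  | 5 => Tilt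
      ((- 48 - 32 * s5) * z1 + (16 - 4 * s5) * z2 + (480 - 32 * s5) * z3 + (-
        12 + 36 * s5) * z4)
      ((36 + 24 * s5) * z1 + (32 - 8 * s5) * z2 + (- 360 + 24 * s5) * z3 + (-
        24 + 72 * s5) * z4)
      (0 * z1 + 22 * z2 + 0 * z3 + (66 + 66 * s5) * z4)
  | _ => Tilt 0 0 0
  end.

(* Coordinates with respect to [kernel_vec], extended to all tilts by reading them
   off four chosen entries of v. *)
Definition kernel_tilt1 (v : nat -> tilt) : R :=
  (- (1 / 396) - 1 / 132 * s5) * cp (v 1) + (1 / 96 + 1 / 96 * s5) * cu (v 2)
    + (- (1 / 176) + 1 / 144 * s5) * cp (v 2) + (1 / 66) * cp (v 4).
Definition kernel_tilt2 (v : nat -> tilt) : R :=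
  (- (1 / 44) - 1 / 44 * s5) * cp (v 1) + (- (1 / 44) + 1 / 44 * s5) * cp (v
    2) + (1 / 22) * cp (v 4).
Definition kernel_tilt3 (v : nat -> tilt) : R :=
  (- (1 / 792) - 1 / 1320 * s5) * cp (v 1) + (1 / 192 + 1 / 480 * s5) * cu (v
    2) + (1 / 528 - 1 / 3168 * s5) * cp (v 2).
Definition kernel_tilt4 (v : nat -> tilt) : R :=
  (- (1 / 264) + 1 / 264 * s5) * cp (v 1) + (1 / 64) * cu (v 2) + (1 / 132 - 1
    / 1056 * s5) * cp (v 2).

(* Rows of the inverse of the linear system formed by eleven contact differentials
   and the four coordinates on the kernel. *)
Definition elim_u (i : nat) : seq R :=
  match i with
  | 1 =>
      [:: 4 / 99 - 4 / 99 * s5; - (16 / 99) - 8 / 99 * s5; 4 / 99 + 4 / 99 *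
        s5]
  | 3 =>
      [:: - (7 / 297) + 1 / 297 * s5; 17 / 66 + 85 / 594 * s5; 19 / 297 + 13 /
        297 * s5; 2 / 27 * s5; 0; 0; 202 / 297 + 98 / 297 * s5; 10 / 9 + 14 /
        27 * s5; 0; - (2 / 33) + 34 / 297 * s5; 10 / 27 - 2 / 27 * s5]
  | 4 =>
      [:: - (4 / 33) - 8 / 99 * s5; 8 / 99 + 20 / 99 * s5; 16 / 99 - 4 / 99 *
        s5; 0; 0; 0; 0; 104 / 99 + 40 / 99 * s5; 0; 0; 104 / 99 - 40 / 99 *
        s5]
  | 5 =>
      [:: - (1 / 27 * s5); - (7 / 54) - 1 / 54 * s5; 5 / 27 - 2 / 27 * s5; 0;
        0; - (2 / 27 * s5); 0; 10 / 27 + 2 / 27 * s5; - (2 / 33) - 34 / 297 *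
        s5; 0; 10 / 9 - 14 / 27 * s5; 202 / 297 - 98 / 297 * s5]
  | _ => [::]
  end.

Definition elim_w (i : nat) : seq R :=
  match i with
  | 1 =>
      [:: - (7 / 33) - 1 / 11 * s5; - (1 / 11) + 1 / 33 * s5; 7 / 33 - 1 / 11
        * s5]
  | 2 =>
      [:: 0; - (1 / 3) - 1 / 3 * s5]
  | 3 =>
      [:: 23 / 99 + 14 / 99 * s5; - (62 / 99) - 7 / 33 * s5; 2 / 99 - 5 / 99 *
        s5; - (2 / 9); 0; 0; - (56 / 99) - 8 / 99 * s5; - (14 / 9) - 2 / 3 *
        s5; 0; - (76 / 99) + 4 / 11 * s5; 2 / 9 - 2 / 9 * s5]
  | 4 =>
      [:: 1 / 11 + 2 / 33 * s5; 3 / 11 + 2 / 11 * s5; - (4 / 33) + 1 / 33 *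
        s5; 0; 0; 0; 0; - (26 / 33) - 10 / 33 * s5; 0; 0; 26 / 33 - 10 / 33 *
        s5]
  | 5 =>
      [:: 1 / 9; - (4 / 9) + 1 / 9 * s5; 2 / 9 - 1 / 9 * s5; 0; 0; 2 / 9; 0; -
        (2 / 9) - 2 / 9 * s5; 76 / 99 + 4 / 11 * s5; 0; 14 / 9 - 2 / 3 * s5;
        56 / 99 - 8 / 99 * s5]
  | _ => [::]
  end.

Definition elim_p (i : nat) : seq R :=
  match i with
  | 3 =>
      [:: 1 / 18 + 1 / 18 * s5; - (11 / 36) - 1 / 12 * s5; 1 / 18 - 1 / 18 *
        s5; - (1 / 9); 0; 0; 1 / 9 + 1 / 9 * s5; - (7 / 9) - 1 / 3 * s5; 0; -
        (7 / 9) + 1 / 3 * s5; 1 / 9 - 1 / 9 * s5]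
  | 5 =>
      [:: 1 / 18; - (11 / 36) - 1 / 36 * s5; 1 / 9 - 1 / 18 * s5; 0; 0; 1 / 9;
        0; - (1 / 9) - 1 / 9 * s5; 7 / 9 + 1 / 3 * s5; 0; 7 / 9 - 1 / 3 * s5;
        - (1 / 9) + 1 / 9 * s5]
  | _ => [::]
  end.

(** Splits into twelve literal indices, so that the tables reduce and [ring] sees polynomials in
    [s5]. *)
Lemma ord12_ind (P : nat -> Prop) : P 0%N -> P 1%N -> P 2%N -> P 3%N -> P 4%N ->
  P 5%N -> P 6%N -> P 7%N -> P 8%N -> P 9%N -> P 10%N -> P 11%N ->
  forall k, (k < 12)%N -> P k.
Proof. by move=> ? ? ? ? ? ? ? ? ? ? ? ?; do 12?[case=> //]. Qed.

Lemma base_contact k : (k < 12)%N -> cclearance (faxis \o base_frame) k = level.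
Proof.
rewrite levelE; move: k; apply: ord12_ind;
rewrite /cclearance /clearance /lmom /ldot /wdot /=; by ring: s5E.
Qed.

Lemma stressE (v : nat -> tilt) : \sum_(k < 12) stress k * cclearance1 v k = 0.
Proof.
rewrite !big_ord_recr big_ord0 /= /stress /=.
rewrite /cclearance1 /= /clearance1 /lmom /ldot /wdot /=.
by ring: s5E.
Qed.

Lemma cclear1_kernel z1 z2 z3 z4 k :
  (k < 12)%N -> cclearance1 (kernel_vec z1 z2 z3 z4) k = 0.
Proof.
move: k; apply: ord12_ind;
rewrite /cclearance1 /clearance1 /lmom /ldot /wdot /=; by ring: s5E.
Qed.

(** No mixed terms survive, so definiteness can be read off the four coefficients. *)
Lemma stress_cclear2_kernel z1 z2 z3 z4 :
  \sum_(k < 12) stress k * cclearance2 (kernel_vec z1 z2 z3 z4) k =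
  - (1152 ^+ 2 * (24 * (45 * (66 * z1) ^+ 2 + 449 * (22 * z2) ^+ 2 +
      847 * (5 * (72 * z3) ^+ 2 + 3 * (24 * z4) ^+ 2)))).
Proof.
rewrite !big_ord_recr big_ord0 /= /stress /=.
rewrite /cclearance2 /= /clearance2 /lmom /ldot /wdot /=.
by ring: s5E.
Qed.
Section Elimination.
Variable v : nat -> tilt.
Hypothesis v0 : v 0 = Tilt 0 0 0.

Let k := kernel_vec (kernel_tilt1 v) (kernel_tilt2 v) (kernel_tilt3 v)
  (kernel_tilt4 v).

Let elimination (c : tilt -> R) (b : nat -> seq R) (i : nat) : Prop :=
  level * (c (v i) - c (k i)) = \sum_(j < 12) (b i)`_j * cclearance1 v j.

(** Both sides are linear in the entries of [v], so this is an identity of linear forms over Q(sqrt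
    5). It makes the distance of a tilt from its kernel projection a fixed linear combination of the
    contact differentials. *)
Lemma elim_uE i : (i < 6)%N -> elimination cu elim_u i.
Proof.
rewrite /elimination levelE /k !big_ord_recr big_ord0.
by do 6?[case: i => [_|i]]; rewrite ?v0 ?nth_nil //=;
  rewrite /kernel_tilt1 /kernel_tilt2 /kernel_tilt3 /kernel_tilt4
    /cclearance1 /= /clearance1 /lmom /ldot /wdot /= ?v0 /=; field: s5E.
Qed.

Lemma elim_wE i : (i < 6)%N -> elimination cw elim_w i.
Proof.
rewrite /elimination levelE /k !big_ord_recr big_ord0.
by do 6?[case: i => [_|i]]; rewrite ?v0 ?nth_nil //=;
  rewrite /kernel_tilt1 /kernel_tilt2 /kernel_tilt3 /kernel_tilt4
    /cclearance1 /= /clearance1 /lmom /ldot /wdot /= ?v0 /=; field: s5E.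
Qed.

Lemma elim_pE i : (i < 6)%N -> elimination cp elim_p i.
Proof.
rewrite /elimination levelE /k !big_ord_recr big_ord0.
by do 6?[case: i => [_|i]]; rewrite ?v0 ?nth_nil //=;
  rewrite /kernel_tilt1 /kernel_tilt2 /kernel_tilt3 /kernel_tilt4
    /cclearance1 /= /clearance1 /lmom /ldot /wdot /= ?v0 /=; field: s5E.
Qed.

End Elimination.
End Lines.

(** * Expansion of the clearances *)

Section LineAlgebra.
Variable R : realFieldType.
Implicit Types (a b c : line R) (F G : frame R).

Lemma ldotDl a b c : ldot (ladd a b) c = ldot a c + ldot b c.
Proof. by rewrite /ldot /wdot /=; ring. Qed.
Lemma ldotDr a b c : ldot c (ladd a b) = ldot c a + ldot c b.
Proof. by rewrite /ldot /wdot /=; ring. Qed.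
Lemma lmomDl a b c : lmom (ladd a b) c = lmom a c + lmom b c.
Proof. by rewrite /lmom /wdot /=; ring. Qed.
Lemma lmomDr a b c : lmom c (ladd a b) = lmom c a + lmom c b.
Proof. by rewrite /lmom /wdot /=; ring. Qed.

End LineAlgebra.

Section LineJets.
Variables (R : realFieldType) (T : Type) (D : T -> Prop) (nu : T -> R).
Hypothesis nu01 : forall t, D t -> 0 <= nu t <= 1.

Local Notation bigO := (isbigO D nu).
Local Notation jet := (jet D nu).

Lemma jet_O1 f : bigO 1 f -> jet f 0 f (fun=> 0).
Proof.
move=> Of; split=> //; first exact: bigO0.
by apply: eq_bigO (bigO0 D nu 3) => t _; ring.
Qed.

Lemma jet_O2 f : bigO 2 f -> jet f 0 (fun=> 0) f.
Proof.
move=> Of; split=> //; first exact: bigO0.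
by apply: eq_bigO (bigO0 D nu 3) => t _; ring.
Qed.

Lemma jet_split f l : bigO 1 l -> bigO 2 (fun t => f t - l t) ->
  jet f 0 l (fun t => f t - l t).
Proof.
move=> Ol Ofl; split=> //.
by apply: eq_bigO (bigO0 D nu 3) => t _; ring.
Qed.

Definition vjet (f : T -> vec R) (c : vec R) (l q : T -> vec R) : Prop :=
  [/\ jet (fun t => v1 (f t)) (v1 c) (fun t => v1 (l t)) (fun t => v1 (q t)),
      jet (fun t => v2 (f t)) (v2 c) (fun t => v2 (l t)) (fun t => v2 (q t))
    & jet (fun t => v3 (f t)) (v3 c) (fun t => v3 (l t)) (fun t => v3 (q t))].

Definition ljet (f : T -> line R) (c : line R) (l q : T -> line R) : Prop :=
  vjet (fun t => ldir (f t)) (ldir c) (fun t => ldir (l t)) (fun t => ldir (q t)) /\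
  vjet (fun t => lnor (f t)) (lnor c) (fun t => lnor (l t)) (fun t => lnor (q t)).

Lemma jet_wdot f c l q f' c' l' q' : vjet f c l q -> vjet f' c' l' q' ->
  jet (fun t => wdot (f t) (f' t)) (wdot c c')
      (fun t => wdot (l t) c' + wdot c (l' t))
      (fun t => wdot (q t) c' + wdot (l t) (l' t) + wdot c (q' t)).
Proof.
move=> [J1 J2 J3] [J1' J2' J3'].
apply: (eq_jet (jetD (jetD (jetM nu01 J1 J1') (jetZ nu01 3 (jetM nu01 J2 J2')))
  (jetZ nu01 6 (jetM nu01 J3 J3')))) => // t _; rewrite /wdot; ring.
Qed.

Lemma jet_ldot f c l q f' c' l' q' : ljet f c l q -> ljet f' c' l' q' ->
  jet (fun t => ldot (f t) (f' t)) (ldot c c')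
      (fun t => ldot (l t) c' + ldot c (l' t))
      (fun t => ldot (q t) c' + ldot (l t) (l' t) + ldot c (q' t)).
Proof.
move=> [J _] [J' _].
by apply: (eq_jet (jetZ nu01 6 (jet_wdot J J'))) => // t _; rewrite /ldot; ring.
Qed.

Lemma jet_lmom f c l q f' c' l' q' : ljet f c l q -> ljet f' c' l' q' ->
  jet (fun t => lmom (f t) (f' t)) (lmom c c')
      (fun t => lmom (l t) c' + lmom c (l' t))
      (fun t => lmom (q t) c' + lmom (l t) (l' t) + lmom c (q' t)).
Proof.
move=> [J1 J2] [J1' J2'].
by apply: (eq_jet (jetD (jet_wdot J1 J2') (jet_wdot J2 J1'))) => // t _;
  rewrite /lmom; ring.
Qed.

(** The tilts are split as [a] plus a second-order correction [b]. The correction reaches the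
    quadratic part only through [clearance1], where the stress can cancel it. *)
Lemma jet_clear (F G : frame R) f g (a b a' b' : T -> tilt R) :
  ljet f (faxis F) (fun t => perturb1 F (a t))
    (fun t => ladd (perturb1 F (b t)) (perturb2 F (a t))) ->
  ljet g (faxis G) (fun t => perturb1 G (a' t))
    (fun t => ladd (perturb1 G (b' t)) (perturb2 G (a' t))) ->
  jet (fun t => clearance (f t) (g t)) (clearance (faxis F) (faxis G))
    (fun t => 2 * clearance1 F G (a t) (a' t))
    (fun t => 2 * clearance1 F G (b t) (b' t) + clearance2 F G (a t) (a' t)).
Proof.
move=> Jf Jg; have [Jd Jm] := (jet_ldot Jf Jg, jet_lmom Jf Jg).
apply: (eq_jet (jetD (jetM nu01 Jd Jd) (jetZ nu01 3 (jetM nu01 Jm Jm)))).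
- by [].
- by [].
- by move=> t _; rewrite /clearance1; ring.
- by move=> t _; rewrite /clearance1 /clearance2 !(ldotDl, ldotDr, lmomDl, lmomDr); ring.
Qed.

Variables (u w p g e f : T -> R).
Hypothesis Ou : bigO 1 u.
Hypothesis Ow : bigO 1 w.
Hypothesis Op : bigO 1 p.
Hypothesis Og : bigO 1 g.
Hypothesis Oe : bigO 1 e.
Hypothesis Of : bigO 1 f.
(** Unit length of the direction, unit length of the normal and their orthogonality, written in the
    coordinates of [perturb]. *)
Hypothesis eE : forall t, 2 * e t = 66 * u t ^+ 2 + 44 * w t ^+ 2 + e t ^+ 2.
Hypothesis fE : forall t, 2 * f t = 24 * p t ^+ 2 + 44 * g t ^+ 2 + f t ^+ 2.
Hypothesis gE : forall t, (1 - e t) * g t = w t * (1 - f t) + 6 * (u t * p t).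

(** The quadratic equation for [e] has a second root near 2, the reversed direction. The hypothesis
    that [e] is of first order selects the small root and makes e^2 / 2 of second order. *)
Lemma e_bigO2 : bigO 2 e.
Proof.
have O := bigOD (bigOD (bigOZ 33 (bigOM Ou Ou)) (bigOZ 22 (bigOM Ow Ow)))
  (bigOZ (1 / 2) (bigOM Oe Oe)).
by apply: eq_bigO O => t _ /=; have := eE t; rewrite !expr2; lra.
Qed.

Lemma f_bigO2 : bigO 2 f.
Proof.
have O := bigOD (bigOD (bigOZ 12 (bigOM Op Op)) (bigOZ 22 (bigOM Og Og)))
  (bigOZ (1 / 2) (bigOM Of Of)).
by apply: eq_bigO O => t _ /=; have := fE t; rewrite !expr2; lra.
Qed.

Variables a b : T -> tilt R.
Hypothesis Ju : jet u 0 (fun t => cu (a t)) (fun t => cu (b t)).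
Hypothesis Jw : jet w 0 (fun t => cw (a t)) (fun t => cw (b t)).
Hypothesis Jp : jet p 0 (fun t => cp (a t)) (fun t => cp (b t)).

Lemma jet_e : jet e 0 (fun=> 0) (fun t => 33 * cu (a t) ^+ 2 + 22 * cw (a t) ^+ 2).
Proof.
have Je := jet_O2 e_bigO2.
apply: (eq_jet (jetD (jetD (jetZ nu01 33 (jetM nu01 Ju Ju))
  (jetZ nu01 22 (jetM nu01 Jw Jw))) (jetZ nu01 (1 / 2) (jetM nu01 Je Je)))).
- by move=> t _; have := eE t; rewrite !expr2; lra.
- by ring.
- by move=> t _; ring.
- by move=> t _; ring.
Qed.

Lemma jet_g : jet g 0 (fun t => cw (a t)) (fun t => cw (b t) + 6 * (cu (a t) * cp (a t))).
Proof.
have [[Je Jf] Jg] := (jet_O2 e_bigO2, jet_O2 f_bigO2, jet_O1 Og).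
apply: (eq_jet (jetD (jetD (jetD Jw (jetZ nu01 (-1) (jetM nu01 Jw Jf)))
  (jetZ nu01 6 (jetM nu01 Ju Jp))) (jetM nu01 Je Jg))).
- by move=> t _; have := gE t; lra.
- by ring.
- by move=> t _; ring.
- by move=> t _; ring.
Qed.

Lemma jet_f : jet f 0 (fun=> 0) (fun t => 12 * cp (a t) ^+ 2 + 22 * cw (a t) ^+ 2).
Proof.
have [Jf Jg] := (jet_O2 f_bigO2, jet_g).
apply: (eq_jet (jetD (jetD (jetZ nu01 12 (jetM nu01 Jp Jp))
  (jetZ nu01 22 (jetM nu01 Jg Jg))) (jetZ nu01 (1 / 2) (jetM nu01 Jf Jf)))).
- by move=> t _; have := fE t; rewrite !expr2; lra.
- by ring.
- by move=> t _; ring.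
- by move=> t _; ring.
Qed.

Lemma ljet_perturb F :
  ljet (fun t => perturb F (u t) (w t) (p t) (g t) (e t) (f t)) (faxis F)
    (fun t => perturb1 F (a t))
    (fun t => ladd (perturb1 F (b t)) (perturb2 F (a t))).
Proof.
have Z c f' l q x : jet f' c l q ->
    jet (fun t => f' t * x) (c * x) (fun t => l t * x) (fun t => q t * x).
  move=> /(jetZ nu01 x) J; apply: (eq_jet J) => [t _||t _|t _]; exact: mulrC.
have [[Je Jf] Jg] := (jet_e, jet_f, jet_g).
have comb x y z h c l q h' c' l' q' : jet h c l q -> jet h' c' l' q' ->
  forall k kc kl kq, jet k kc kl kq ->
  jet (fun t => (1 - k t) * x + (h t * y + h' t * z))
    ((1 - kc) * x + (c * y + c' * z))
    (fun t => - kl t * x + (l t * y + l' t * z))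
    (fun t => - kq t * x + (q t * y + q' t * z)).
  move=> Jh Jh' k kc kl kq Jk.
  have J1 := Z _ _ _ _ x (jetD (jet_cst D nu 1) (jetZ nu01 (-1) Jk)).
  have J := jetD J1 (jetD (Z _ _ _ _ y Jh) (Z _ _ _ _ z Jh')).
  apply: (eq_jet J) => [t _||t _|t _]; ring.
case: F => [[x1 x2 x3] [[X1 X2 X3] [m1 m2 m3]]]; split; split=> /=.
- apply: (eq_jet (comb X1 x1 m1 _ _ _ _ _ _ _ _ (jetZ nu01 12 Ju) (jetZ nu01 2 Jw) _ _ _ _ Je));
  by [move=> *; ring|ring].
- apply: (eq_jet (comb X2 x2 m2 _ _ _ _ _ _ _ _ (jetZ nu01 12 Ju) (jetZ nu01 2 Jw) _ _ _ _ Je));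
  by [move=> *; ring|ring].
- apply: (eq_jet (comb X3 x3 m3 _ _ _ _ _ _ _ _ (jetZ nu01 12 Ju) (jetZ nu01 2 Jw) _ _ _ _ Je));
  by [move=> *; ring|ring].
- apply: (eq_jet (comb m1 x1 X1 _ _ _ _ _ _ _ _ (jetZ nu01 24 Jp) (jetZ nu01 (-22) Jg) _ _ _ _ Jf));
  by [move=> *; ring|ring].
- apply: (eq_jet (comb m2 x2 X2 _ _ _ _ _ _ _ _ (jetZ nu01 24 Jp) (jetZ nu01 (-22) Jg) _ _ _ _ Jf));
  by [move=> *; ring|ring].
- apply: (eq_jet (comb m3 x3 X3 _ _ _ _ _ _ _ _ (jetZ nu01 24 Jp) (jetZ nu01 (-22) Jg) _ _ _ _ Jf));
  by [move=> *; ring|ring].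
Qed.

End LineJets.

(** * Local rigidity *)

Section LocalRigidity.
Variables (R : realFieldType) (s5 : R).
Hypothesis s5E : s5 ^+ 2 = 5.
Hypothesis s5_ge0 : 0 <= s5.

Lemma level_gt0 : 0 < level R.
Proof. by rewrite levelE; apply: exprn_gt0; rewrite ltr0n. Qed.

Lemma level_neq0 : level R != 0.
Proof. by rewrite gt_eqF// level_gt0. Qed.

Lemma stress_gt0 k : (k < 12)%N -> 0 < stress s5 k.
Proof.
have s53 : s5 < 3 by rewrite ltNge; apply/negP => s53; move: s5E; nra.
have s50 := s5_ge0; by move: k; apply: ord12_ind; rewrite /stress /=; lra.
Qed.

Variables (T : Type) (u w p g e f : nat -> T -> R).

(** [g], [e] and [f] are included so that a small deviation rules out the branch in which a
    direction or normal is nearly reversed. *)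
Definition deviation1 (i : nat) (t : T) : R :=
  `|u i t| + `|w i t| + `|p i t| + `|g i t| + `|e i t| + `|f i t|.
Definition deviation (t : T) : R := \sum_(i < 6) deviation1 i t.
Definition moved_lines (t : T) (i : nat) : line R :=
  perturb (base_frame s5 i) (u i t) (w i t) (p i t) (g i t) (e i t) (f i t).

Hypothesis u0 : forall t, u 0%N t = 0.
Hypothesis w0 : forall t, w 0%N t = 0.
Hypothesis p0 : forall t, p 0%N t = 0.
Hypothesis eE : forall i t, 2 * e i t = 66 * u i t ^+ 2 + 44 * w i t ^+ 2 + e i t ^+ 2.
Hypothesis fE : forall i t, 2 * f i t = 24 * p i t ^+ 2 + 44 * g i t ^+ 2 + f i t ^+ 2.
Hypothesis gE : forall i t, (1 - e i t) * g i t = w i t * (1 - f i t) + 6 * (u i t * p i t).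
Hypothesis clearP : forall k t, (k < 12)%N -> level R <= cclearance (moved_lines t) k.

Let D t := deviation t <= 1.

Lemma deviation1_ge0 i t : 0 <= deviation1 i t.
Proof. by rewrite !addr_ge0. Qed.

Lemma deviation_ge0 t : 0 <= deviation t.
Proof. by apply: sumr_ge0 => i _; exact: deviation1_ge0. Qed.

Let nu01 t : D t -> 0 <= deviation t <= 1.
Proof. by move=> Dt; rewrite deviation_ge0. Qed.

Local Notation bigO := (isbigO D deviation).
Local Notation jet := (jet D deviation).

Lemma deviation1_le i t : (i < 6)%N -> deviation1 i t <= deviation t.
Proof.
move=> i6; rewrite /deviation (bigD1 (Ordinal i6))//= lerDl.
by apply: sumr_ge0 => j _; exact: deviation1_ge0.
Qed.

Lemma deviation1_bigO1 (x : nat -> T -> R) i : (i < 6)%N ->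
  (forall t, `|x i t| <= deviation1 i t) -> bigO 1 (x i).
Proof.
move=> i6 xs; exists 1 => // t _.
by rewrite mul1r expr1 (le_trans (xs t))// deviation1_le.
Qed.

Let small i t : [/\ `|u i t| <= deviation1 i t, `|w i t| <= deviation1 i t & `|p i t| <= deviation1 i t] /\
  [/\ `|g i t| <= deviation1 i t, `|e i t| <= deviation1 i t & `|f i t| <= deviation1 i t].
Proof.
rewrite /deviation1; move: (normr_ge0 (u i t)) (normr_ge0 (w i t)) (normr_ge0 (p i t))
  (normr_ge0 (g i t)) (normr_ge0 (e i t)) (normr_ge0 (f i t)).
by move=> *; split; split; lra.
Qed.

Lemma u_bigO1 i : (i < 6)%N -> bigO 1 (u i).
Proof. by move=> i6; apply: deviation1_bigO1 => // t; have [[]] := small i t. Qed.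
Lemma w_bigO1 i : (i < 6)%N -> bigO 1 (w i).
Proof. by move=> i6; apply: deviation1_bigO1 => // t; have [[]] := small i t. Qed.
Lemma p_bigO1 i : (i < 6)%N -> bigO 1 (p i).
Proof. by move=> i6; apply: deviation1_bigO1 => // t; have [[]] := small i t. Qed.
Lemma g_bigO1 i : (i < 6)%N -> bigO 1 (g i).
Proof. by move=> i6; apply: deviation1_bigO1 => // t; have [_ []] := small i t. Qed.
Lemma e_bigO1 i : (i < 6)%N -> bigO 1 (e i).
Proof. by move=> i6; apply: deviation1_bigO1 => // t; have [_ []] := small i t. Qed.
Lemma f_bigO1 i : (i < 6)%N -> bigO 1 (f i).
Proof. by move=> i6; apply: deviation1_bigO1 => // t; have [_ []] := small i t. Qed.

Lemma jet_cclear (a b : T -> nat -> tilt R) :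
  (forall i, (i < 6)%N ->
    [/\ jet (u i) 0 (fun t => cu (a t i)) (fun t => cu (b t i)),
        jet (w i) 0 (fun t => cw (a t i)) (fun t => cw (b t i))
      & jet (p i) 0 (fun t => cp (a t i)) (fun t => cp (b t i))]) ->
  forall k, (k < 12)%N ->
  jet (fun t => cclearance (moved_lines t) k) (level R)
    (fun t => 2 * cclearance1 s5 (a t) k)
    (fun t => 2 * cclearance1 s5 (b t) k + cclearance2 s5 (a t) k).
Proof.
move=> Jab k k12.
have [i6 j6] : ((contact k).1 < 6)%N /\ ((contact k).2 < 6)%N.
  by move: k k12; apply: ord12_ind.
rewrite -(base_contact s5E k12) /cclearance /cclearance1 /cclearance2.
move: (contact k).1 (contact k).2 i6 j6 => i j i6 j6.
have [Ju Jw Jp] := Jab _ i6; have [Ju' Jw' Jp'] := Jab _ j6.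
apply: (jet_clear nu01 (a := a ^~ i) (b := b ^~ i) (a' := a ^~ j) (b' := b ^~ j)).
- apply: (ljet_perturb nu01 (u_bigO1 i6) (w_bigO1 i6) (p_bigO1 i6) (g_bigO1 i6)
    (e_bigO1 i6) (f_bigO1 i6)) => //.
- apply: (ljet_perturb nu01 (u_bigO1 j6) (w_bigO1 j6) (p_bigO1 j6) (g_bigO1 j6)
    (e_bigO1 j6) (f_bigO1 j6)) => //.
Qed.

Definition tilts (t : T) (i : nat) : tilt R := Tilt (u i t) (w i t) (p i t).

Let tilts0 t : tilts t 0 = Tilt 0 0 0.
Proof. by rewrite /tilts u0 w0 p0. Qed.

Definition excess (t : T) : R := \sum_(k < 12) stress s5 k * (cclearance (moved_lines t) k - level R).

Lemma excess_ge (k : 'I_12) t : stress s5 k * (cclearance (moved_lines t) k - level R) <= excess t.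
Proof.
rewrite /excess (bigD1 k) //.
rewrite lerDl.
apply: sumr_ge0 => j _.
apply: mulr_ge0.
  rewrite ltW ?stress_gt0//.
rewrite subr_ge0 clearP//.
Qed.

Lemma excess_ge0 t : 0 <= excess t.
Proof.
by apply: sumr_ge0 => j _; apply: mulr_ge0; [rewrite ltW ?stress_gt0|rewrite subr_ge0 clearP].
Qed.

(* All contact terms are nonnegative and the stress cancels their first-order
   parts, so each of them is in fact of second order. *)
Lemma cclear1_bigO2 k : (k < 12)%N -> bigO 2 (fun t => cclearance1 s5 (tilts t) k).
Proof.
(* Here the whole tilt is taken as first-order part, with zero correction. *)
pose z (_ : T) (_ : nat) : tilt R := Tilt 0 0 0.
have J := @jet_cclear tilts z (fun i i6 =>
  And3 (jet_O1 (u_bigO1 i6)) (jet_O1 (w_bigO1 i6)) (jet_O1 (p_bigO1 i6))).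
have O2 j : (j < 12)%N ->
    bigO 2 (fun t => cclearance (moved_lines t) j - level R - 2 * cclearance1 s5 (tilts t) j).
  move=> j12; apply: (jet_bigO2 (q := fun t => 2 * cclearance1 s5 (z t) j + cclearance2 s5 (tilts t) j) nu01).
  apply: (eq_jet (jetD (J j j12) (jet_cst D deviation (- level R)))) => [t _||t _|t _]; ring.
have Oex : bigO 2 excess.
  apply: (eq_bigO _ (bigO_sum (index_enum 'I_12) (F := fun (j : 'I_12) t => stress s5 j *
    (cclearance (moved_lines t) j - level R - 2 * cclearance1 s5 (tilts t) j)) _)); last first.
    by move=> j; apply: bigOZ; exact: O2.
  move=> t _.
  transitivity (excess t - 2 * \sum_(j < 12) stress s5 j * cclearance1 s5 (tilts t) j).
    by rewrite /excess mulr_sumr -sumrB; apply: eq_bigr => j _; ring.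
  by rewrite stressE// mulr0 subr0.
move=> k12.
have Oc : bigO 2 (fun t => cclearance (moved_lines t) k - level R).
  have [C C0 CP] := Oex; exists ((stress s5 k)^-1 * C).
    by rewrite mulr_ge0// invr_ge0 ltW// stress_gt0.
  move=> t Dt; rewrite -mulrA ler_pdivlMl ?stress_gt0//.
  rewrite ger0_norm ?subr_ge0 ?clearP//.
  apply: le_trans (excess_ge (Ordinal k12) t) _.
  by apply: le_trans (CP t Dt); exact: ler_norm.
apply: eq_bigO (bigOZ (1 / 2) (bigOB Oc (O2 k k12))) => t _; lra.
Qed.

Let z1 t := kernel_tilt1 s5 (tilts t).
Let z2 t := kernel_tilt2 s5 (tilts t).
Let z3 t := kernel_tilt3 s5 (tilts t).
Let z4 t := kernel_tilt4 s5 (tilts t).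
Let kv t := kernel_vec s5 (z1 t) (z2 t) (z3 t) (z4 t).

Lemma tilts_kernel i : (i < 6)%N ->
  [/\ bigO 2 (fun t => u i t - cu (kv t i)), bigO 2 (fun t => w i t - cw (kv t i))
    & bigO 2 (fun t => p i t - cp (kv t i))].
Proof.
move=> i6.
have sumO (b : seq R) : bigO 2 (fun t => \sum_(j < 12) b`_j * cclearance1 s5 (tilts t) j).
  apply: bigO_sum => j; apply: bigOZ; exact: cclear1_bigO2.
have E (x y : R) : level R * x = y -> (level R)^-1 * y = x.
  by move=> <-; rewrite mulKf// level_neq0.
split; apply: (eq_bigO _ (bigOZ (level R)^-1 (sumO _))) => t _; apply: E.
- exact: (elim_uE s5E (tilts0 t) i6).
- exact: (elim_wE s5E (tilts0 t) i6).
- exact: (elim_pE s5E (tilts0 t) i6).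
Qed.

Let quad t := 1152 ^+ 2 * (24 * (45 * (66 * z1 t) ^+ 2 + 449 * (22 * z2 t) ^+ 2 +
  847 * (5 * (72 * z3 t) ^+ 2 + 3 * (24 * z4 t) ^+ 2))).

(** The tilt is split as kernel vector plus second-order remainder. The linear part vanishes on the
    kernel, the remainder is cancelled by [stressE], and only the quadratic form on the kernel is
    left. *)
Lemma excess_quad : bigO 3 (fun t => excess t + quad t).
Proof.
pose b t i := csub (tilts t i) (kv t i).
have J : forall i, (i < 6)%N ->
    [/\ jet (u i) 0 (fun t => cu (kv t i)) (fun t => cu (b t i)),
        jet (w i) 0 (fun t => cw (kv t i)) (fun t => cw (b t i))
      & jet (p i) 0 (fun t => cp (kv t i)) (fun t => cp (b t i))].
  have split_O1 x l : bigO 1 x -> bigO 2 (fun t => x t - l t) ->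
      jet x 0 l (fun t => x t - l t).
    move=> Ox Oxl; apply: jet_split => //.
    apply: eq_bigO (bigOB Ox (bigOW nu01 (isT : (1 <= 2)%N) Oxl)) => t _; ring.
  move=> i i6; have [Ou Ow Op] := tilts_kernel i6.
  by split; apply: split_O1 => //; [exact: u_bigO1|exact: w_bigO1|exact: p_bigO1].
have Jc := jet_cclear J.
have Os : bigO 3 (fun t => \sum_(k < 12) stress s5 k *
    (cclearance (moved_lines t) k - (level R + 2 * cclearance1 s5 (kv t) k +
      (2 * cclearance1 s5 (b t) k + cclearance2 s5 (kv t) k)))).
  by apply: bigO_sum => k; apply: bigOZ; have [] := Jc k (ltn_ord k).
apply: eq_bigO Os => t _.
have Sb := stressE s5E (b t).
have Sk := stress_cclear2_kernel s5E (z1 t) (z2 t) (z3 t) (z4 t).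
transitivity (excess t - 2 * (\sum_(k < 12) stress s5 k * cclearance1 s5 (b t) k) -
    \sum_(k < 12) stress s5 k * cclearance2 s5 (kv t) k); last first.
  by rewrite Sb Sk mulr0 subr0 opprK.
rewrite /excess mulr_sumr -!sumrB; apply: eq_bigr => k _.
by rewrite (cclear1_kernel s5E)//; ring.
Qed.

Let zeta t := `|z1 t| + `|z2 t| + `|z3 t| + `|z4 t|.

(** By Cauchy-Schwarz zeta^2 is at most 4 times the sum of squares, and every coefficient of [quad]
    far exceeds 4. *)
Lemma zeta_quad t : zeta t ^+ 2 <= quad t.
Proof.
have sq (x : R) : `|x| ^+ 2 = x ^+ 2 by rewrite real_normK// num_real.
have am : zeta t ^+ 2 <= 4 * (z1 t ^+ 2 + z2 t ^+ 2 + z3 t ^+ 2 + z4 t ^+ 2).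
  rewrite /zeta -(sq (z1 t)) -(sq (z2 t)) -(sq (z3 t)) -(sq (z4 t)); move: `|z1 t| `|z2 t| `|z3 t| `|z4 t| => x1 x2 x3 x4.
  have := addr_ge0 (addr_ge0 (addr_ge0 (sqr_ge0 (x1 - x2)) (sqr_ge0 (x1 - x3)))
    (addr_ge0 (sqr_ge0 (x1 - x4)) (sqr_ge0 (x2 - x3))))
    (addr_ge0 (sqr_ge0 (x2 - x4)) (sqr_ge0 (x3 - x4))).
  rewrite !expr2; lra.
apply: le_trans am _; rewrite /quad !exprMn.
move: (sqr_ge0 (z1 t)) (sqr_ge0 (z2 t)) (sqr_ge0 (z3 t)) (sqr_ge0 (z4 t)).
by rewrite !expr2; lra.
Qed.

(** Up to second order, [u], [w] and [p] are linear in the four kernel coordinates, [g] equals [w],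
    and [e] and [f] vanish. *)
Lemma deviation_zeta : exists2 C, 0 <= C &
  forall t, D t -> deviation t <= C * (zeta t + deviation t ^+ 2).
Proof.
(* Second order in the deviation becomes first order in [nu']. As [nu'] may exceed 1, only sums and
   multiples by constants are formed at this scale. *)
pose nu' t := zeta t + deviation t ^+ 2.
have zeta_ge0 t : 0 <= zeta t by rewrite /zeta !addr_ge0.
have O2 x : bigO 2 x -> isbigO D nu' 1 x.
  move=> [C C0 CP]; exists C => // t Dt; apply: le_trans (CP t Dt) _.
  by rewrite ler_wpM2l// expr1 lerDr.
have Oz : [/\ isbigO D nu' 1 z1, isbigO D nu' 1 z2, isbigO D nu' 1 z3
    & isbigO D nu' 1 z4].
  by split; exists 1 => // t _; rewrite mul1r expr1 /nu' /zeta;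
    move: (normr_ge0 (z1 t)) (normr_ge0 (z2 t)) (normr_ge0 (z3 t))
      (normr_ge0 (z4 t)) (sqr_ge0 (deviation t)) => *; lra.
have Okv i : (i < 6)%N -> [/\ isbigO D nu' 1 (fun t => cu (kv t i)),
    isbigO D nu' 1 (fun t => cw (kv t i)) & isbigO D nu' 1 (fun t => cp (kv t i))].
  have [Oz1 Oz2 Oz3 Oz4] := Oz.
  have comb a1 a2 a3 a4 := bigOD (bigOD (bigOD (bigOZ a1 Oz1) (bigOZ a2 Oz2))
    (bigOZ a3 Oz3)) (bigOZ a4 Oz4).
  by do 6?[case: i => [_|i]] => //; split; (exact: bigO0 || exact: comb).
have Ouwp i : (i < 6)%N -> [/\ isbigO D nu' 1 (u i), isbigO D nu' 1 (w i)
    & isbigO D nu' 1 (p i)].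
  move=> i6; have [Z1 Z2 Z3] := tilts_kernel i6; have [K1 K2 K3] := Okv i i6.
  by split; [apply: eq_bigO (bigOD K1 (O2 _ Z1))|apply: eq_bigO (bigOD K2 (O2 _ Z2))
    |apply: eq_bigO (bigOD K3 (O2 _ Z3))] => t _; ring.
have Oe i (i6 : (i < 6)%N) : isbigO D nu' 1 (e i).
  by apply: O2; apply: (e_bigO2 (u_bigO1 i6) (w_bigO1 i6) (e_bigO1 i6)).
have Of i (i6 : (i < 6)%N) : bigO 2 (f i).
  by apply: (f_bigO2 (p_bigO1 i6) (g_bigO1 i6) (f_bigO1 i6)).
have Og i (i6 : (i < 6)%N) : isbigO D nu' 1 (g i).
  have [_ Ow _] := Ouwp i i6.
  have Jg := jet_g nu01 (u_bigO1 i6) (w_bigO1 i6) (p_bigO1 i6) (g_bigO1 i6)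
    (e_bigO1 i6) (f_bigO1 i6) (eE i) (fE i) (gE i) (a := fun t => tilts t i)
    (b := fun=> Tilt 0 0 0)
    (jet_O1 (u_bigO1 i6)) (jet_O1 (w_bigO1 i6)) (jet_O1 (p_bigO1 i6)).
  by apply: eq_bigO (bigOD Ow (O2 _ (jet_bigO2 nu01 Jg))) => t _ /=; ring.
have norm x : isbigO D nu' 1 x -> isbigO D nu' 1 (fun t => `|x t|).
  by move=> [C C0 CP]; exists C => // t Dt; rewrite normr_id CP.
have [C C0 CP] : isbigO D nu' 1 deviation.
  apply: bigO_sum => i; have [Ou Ow Op] := Ouwp i (ltn_ord i).
  rewrite /deviation1; repeat (apply: bigOD); apply: norm => //.
  - exact: Og.
  - exact: Oe.
  - exact: O2 (Of _ _).
by exists C => // t Dt; apply: le_trans (ler_norm _) _; have := CP t Dt; rewrite expr1.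
Qed.

Theorem local_rigidity :
  exists2 eps : R, 0 < eps & forall t, deviation t < eps -> deviation t = 0.
Proof.
have [C C0 CP] := excess_quad.
have [K K0 KP] := deviation_zeta.
(* The three bounds serve to enter [D], to absorb K nu^2 into nu / 2, and to get 4 K^2 C nu < 1. The
   summands 1 keep the denominators positive when [K] or [C] is 0. *)
exists (Num.min 1 (Num.min (2 * K + 1)^-1 (4 * K ^+ 2 * C + 1)^-1)).
  rewrite !lt_min ltr01 !invr_gt0 !ltr_wpDl//.
    by rewrite !mulr_ge0// sqr_ge0.
  by rewrite mulr_ge0.
move=> t; rewrite !lt_min => /and3P[nu1 nuK nuC].
have Dt : D t by exact: ltW.
have := deviation_ge0 t; rewrite le_eqVlt => /predU1P[//|nu_gt0]; exfalso.
move: (CP t Dt) (KP t Dt) (excess_ge0 t) (zeta_quad t) => CPt KPt ex0 zq.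
set nu := deviation t in nu1 nuK nuC nu_gt0 CPt KPt.
have z0 : 0 <= zeta t by rewrite /zeta !addr_ge0.
have Q : zeta t ^+ 2 <= C * nu ^+ 3.
  apply: le_trans zq _; apply: le_trans CPt.
  by apply: le_trans (ler_norm _); rewrite lerDr.
have nuK' : nu * (2 * K + 1) < 1.
  by rewrite -ltr_pdivlMr ?div1r// ltr_wpDl// mulr_ge0.
have nuC' : nu * (4 * K ^+ 2 * C + 1) < 1.
  by rewrite -ltr_pdivlMr ?div1r// ltr_wpDl// !mulr_ge0// sqr_ge0.
have lin : nu <= 2 * K * zeta t.
  have : nu * (nu * (2 * K + 1)) <= nu * 1 by rewrite ler_pM2l// ltW.
  rewrite expr2 in KPt; have := mulr_ge0 (ltW nu_gt0) (ltW nu_gt0).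
  by move: KPt; lra.
have sq : nu ^+ 2 <= 4 * K ^+ 2 * (C * nu ^+ 3).
  apply: (@le_trans _ _ ((2 * K * zeta t) ^+ 2)).
    by apply: lerXn2r => //; rewrite nnegrE ?mulr_ge0// ltW.
  rewrite !exprMn (_ : 2 ^+ 2 = 4); last by ring.
  by rewrite ler_wpM2l// mulr_ge0// sqr_ge0.
have : nu ^+ 2 * 1 <= nu ^+ 2 * (4 * K ^+ 2 * C * nu).
  by rewrite mulr1; apply: le_trans sq _; rewrite le_eqVlt; apply/orP; left; apply/eqP; ring.
rewrite ler_pM2l ?exprn_gt0//; move: nuC' nu_gt0; lra.
Qed.

End LocalRigidity.

(** * Tubes in Euclidean space *)
Section Continuity.
Variables (R : realType) (T : topologicalType).
Implicit Types f g : T -> R.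

Lemma fctD_continuous f g : continuous f -> continuous g -> continuous (fun x => f x + g x).
Proof. by move=> cf cg x; exact: cvgD (cf x) (cg x). Qed.

Lemma fctM_continuous f g : continuous f -> continuous g -> continuous (fun x => f x * g x).
Proof. by move=> cf cg x; exact: cvgM (cf x) (cg x). Qed.

Lemma fctN_continuous f : continuous f -> continuous (fun x => - f x).
Proof. by move=> cf x; exact: cvgN (cf x). Qed.

Lemma fct_norm_continuous f : continuous f -> continuous (fun x => `|f x|).
Proof. by move=> cf x; exact: cvg_norm (cf x). Qed.

Lemma fct_sum_continuous (I : Type) (r : seq I) (F : I -> T -> R) :
  (forall i, continuous (F i)) -> continuous (fun x => \sum_(i <- r) F i x).
Proof.
move=> cF; elim: r => [|i r IHr].
  by rewrite (_ : (fun _ => _) = cst 0); [exact: cst_continuous|apply/funext => x; rewrite big_nil].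
rewrite (_ : (fun _ => _) = fun x => F i x + \sum_(j <- r) F j x).
  exact: fctD_continuous.
by apply/funext => x; rewrite big_cons.
Qed.

End Continuity.

Section Euclid.
Variable R : realType.
Implicit Types (u v w x y z d c : 'cV[R]_3) (a b k s r : R).

Lemma dotE u v : dot u v = u 0 0 * v 0 0 + u 1 0 * v 1 0 + u 2 0 * v 2 0.
Proof.
rewrite /dot !big_ord_recr big_ord0 /= add0r.
by congr (_ * _ + _ * _ + _ * _); congr (_ _ _); apply: val_inj.
Qed.

Lemma vec3E (a b k : R) :
  (vec3 a b k 0 0 = a) * (vec3 a b k 1 0 = b) * (vec3 a b k 2 0 = k).
Proof. by rewrite /vec3 !mxE. Qed.

Lemma col3P u v : u 0 0 = v 0 0 -> u 1 0 = v 1 0 -> u 2 0 = v 2 0 -> u = v.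
Proof.
move=> e0 e1 e2; apply/colP => i; case: i => [[|[|[|//]]]] Hi.
- by move: e0; congr (_ = _); congr (_ _ _); apply: val_inj.
- by move: e1; congr (_ = _); congr (_ _ _); apply: val_inj.
- by move: e2; congr (_ = _); congr (_ _ _); apply: val_inj.
Qed.

Lemma dotC u v : dot u v = dot v u.
Proof. by rewrite !dotE; ring. Qed.
Lemma dotDl u v w : dot (u + v) w = dot u w + dot v w.
Proof. by rewrite !dotE !mxE; ring. Qed.
Lemma dotZl a u v : dot (a *: u) v = a * dot u v.
Proof. by rewrite !dotE !mxE; ring. Qed.
Lemma dotNl u v : dot (- u) v = - dot u v.
Proof. by rewrite !dotE !mxE; ring. Qed.
Lemma dotDr u v w : dot w (u + v) = dot w u + dot w v.
Proof. by rewrite !dotE !mxE; ring. Qed.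
Lemma dotZr a u v : dot v (a *: u) = a * dot v u.
Proof. by rewrite !dotE !mxE; ring. Qed.
Lemma dotNr u v : dot v (- u) = - dot v u.
Proof. by rewrite !dotE !mxE; ring. Qed.
Definition dot_lin := (dotDl, dotZl, dotNl, dotDr, dotZr, dotNr).

Lemma dot_ge0 u : 0 <= dot u u.
Proof. by rewrite dotE !addr_ge0// -expr2 sqr_ge0. Qed.

Lemma dot_eq0 u : dot u u = 0 -> u = 0.
Proof.
rewrite dotE -!expr2 => e.
have [s0 s1 s2] := And3 (sqr_ge0 (u 0 0)) (sqr_ge0 (u 1 0)) (sqr_ge0 (u 2 0)).
by apply: col3P; rewrite !mxE; apply/eqP; rewrite -sqrf_eq0; apply/eqP; lra.
Qed.

Lemma enorm_ge0 u : 0 <= enorm u. Proof. exact: sqrtr_ge0. Qed.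

Lemma enormN u : enorm (- u) = enorm u.
Proof. by rewrite /enorm dotNl dotNr opprK. Qed.

Lemma enormE u : enorm u ^+ 2 = dot u u.
Proof. by rewrite sqr_sqrtr ?dot_ge0. Qed.

Lemma enorm_lt u r : 0 < r -> (enorm u < r) = (dot u u < r ^+ 2).
Proof.
move=> r0; rewrite -enormE ltr_sqr ?nnegrE ?enorm_ge0 ?ltW//.
Qed.

Lemma enorm_le u r : 0 <= r -> (enorm u <= r) = (dot u u <= r ^+ 2).
Proof. by move=> r0; rewrite -enormE ler_sqr ?nnegrE ?enorm_ge0. Qed.

Lemma dot_lagrange u v : dot u u * dot v v = dot u v ^+ 2 + dot (cross u v) (cross u v).
Proof. by rewrite !dotE /cross !vec3E; ring. Qed.

Lemma dot_cross u v : dot (cross u v) (cross u v) = dot u u * dot v v - dot u v ^+ 2.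
Proof. by rewrite dot_lagrange; ring. Qed.

Lemma cauchy_schwarz u v : dot u v <= enorm u * enorm v.
Proof.
apply: le_trans (ler_norm _) _.
rewrite -(@ler_pXn2r _ 2) ?nnegrE ?normr_ge0 ?mulr_ge0 ?enorm_ge0//.
rewrite exprMn !enormE dot_lagrange real_normK ?num_real// lerDl; exact: dot_ge0.
Qed.

Definition tube c d r : set 'cV[R]_3 := [set p | exists s, enorm (p - (c + s *: d)) < r].

Lemma tubeP c d r p : 0 < r -> dot d d = 1 ->
  tube c d r p <-> dot (p - c) (p - c) - dot (p - c) d ^+ 2 < r ^+ 2.
Proof.
move=> r0 d1.
(* Completing the square in [s]: the minimum is at the foot of the perpendicular from [p]. *)
have E s : dot (p - (c + s *: d)) (p - (c + s *: d)) =
    dot (p - c) (p - c) - dot (p - c) d ^+ 2 + (s - dot (p - c) d) ^+ 2.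
  by rewrite opprD addrA; move: (p - c) => q; rewrite !dot_lin (dotC d q) d1; ring.
split=> [[s]|h]; rewrite ?enorm_lt//.
  by rewrite E; apply: le_lt_trans; rewrite lerDl sqr_ge0.
by exists (dot (p - c) d); rewrite enorm_lt// E subrr expr0n addr0.
Qed.

Lemma tube_shift c d r k : tube (c + k *: d) d r = tube c d r.
Proof.
apply/seteqP; split=> p [s ps]; [exists (k + s)|exists (s - k)];
  by move: ps; rewrite -addrA -scalerDl ?(addrC k) ?subrK// addrC.
Qed.

Lemma orthogonal_dot (A : 'M[R]_3) u v : orthogonal_mx A -> dot (A *m u) (A *m v) = dot u v.
Proof.
have E x y : dot x y = (x^T *m y) 0 0.
  by rewrite /dot mxE; apply: eq_bigr => i _; rewrite mxE.
by move=> AA; rewrite !E trmx_mul mulmxA -(mulmxA u^T) AA mulmx1.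
Qed.

Lemma orthogonal_mxC (A : 'M[R]_3) : orthogonal_mx A -> A *m A^T = 1%:M.
Proof. exact: mulmx1C. Qed.

Lemma orthogonal_enorm (A : 'M[R]_3) u : orthogonal_mx A -> enorm (A *m u) = enorm u.
Proof. by move=> AA; rewrite /enorm orthogonal_dot. Qed.

Lemma tube_motion (A : 'M[R]_3) (m : 'cV[R]_3) c d r : orthogonal_mx A ->
  [set A *m p + m | p in tube c d r] = tube (A *m c + m) (A *m d) r.
Proof.
move=> AA; apply/seteqP; split=> [_ [p [s ps] <-]|q [s qs]].
  exists s; rewrite (_ : _ - _ = A *m (p - (c + s *: d))) ?orthogonal_enorm//.
  rewrite mulmxBr mulmxDr -scalemxAr; apply/matrixP => i j; rewrite !mxE; ring.
have AV : A *m (A^T *m (q - m)) = q - m by rewrite mulmxA orthogonal_mxC// mul1mx.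
move: (A^T *m (q - m)) AV => y AV; exists y; last by rewrite AV subrK.
exists s; rewrite -(orthogonal_enorm _ AA) mulmxDr AV mulmxN mulmxDr -scalemxAr.
by move: qs; congr (enorm _ < _); apply/matrixP => i j; rewrite !mxE; ring.
Qed.

Lemma continuous_dot c : continuous (dot c).
Proof.
rewrite (_ : dot c = fun v => c 0 0 * v 0 0 + c 1 0 * v 1 0 + c 2 0 * v 2 0); last first.
  by apply/funext => v; rewrite dotE.
by do 2?apply: fctD_continuous; apply: fctM_continuous;
  (exact: cst_continuous || exact: coord_continuous).
Qed.

(** Let c' be the foot of the perpendicular from the origin to the axis. If c' is nearer than 1 + r,
    then c' / (1 + r) lies in both the tube and the open ball. If it is farther, the half-space c' .
    p >= |c'| (|c'| - r) contains the closure of the tube and misses the closed ball. *)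
Lemma touches_tube_dist c d r : 0 < r -> dot d d = 1 -> touches_ball (tube c d r) ->
  enorm (c - dot c d *: d) = 1 + r.
Proof.
move=> r0 d1 [dis [q [clq q1]]].
have c'd : dot (c - dot c d *: d) d = 0 by rewrite !dot_lin d1 mulr1 subrr.
have tubeE : tube c d r = tube (c - dot c d *: d) d r by rewrite -scaleNr tube_shift.
move: (c - dot c d *: d) c'd tubeE => c' c'd tubeE.
have r1 : 0 < 1 + r by rewrite addr_gt0.
apply/eqP; rewrite eq_le; apply/andP; split; last first.
  rewrite leNgt; apply/negP => lt.
  have : (tube c d r `&` open_ball) ((1 + r)^-1 *: c').
    have lt2 : dot c' c' < (1 + r) ^+ 2 by rewrite -enorm_lt.
    split.
      rewrite tubeE; apply/tubeP => //.
      have -> : (1 + r)^-1 *: c' - c' = ((1 + r)^-1 - 1) *: c' by rewrite scalerBl scale1r.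
      rewrite !dot_lin c'd mulr0 expr0n subr0.
      rewrite mulrA -expr2 (_ : _ - 1 = - (r / (1 + r))); last by field; rewrite gt_eqF.
      rewrite sqrrN expr_div_n mulrAC ltr_pdivrMr ?exprn_gt0//.
      by rewrite ltr_pM2l// exprn_gt0.
    rewrite /open_ball /= enorm_lt// !dot_lin mulrA -invfM -expr2 expr1n.
    by rewrite ltr_pdivrMl ?exprn_gt0// mulr1.
  by rewrite dis.
have [->|n0] := eqVneq (enorm c') 0; first exact: ltW.
have npos : 0 < enorm c' by rewrite lt_def n0 enorm_ge0.
have cl : closed [set p | enorm c' * (enorm c' - r) <= dot c' p].
  apply: (@closed_comp _ _ (dot c') [set y | enorm c' * (enorm c' - r) <= y]).
    by move=> x _; exact: continuous_dot.
  exact: closed_ge.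
have : [set p | enorm c' * (enorm c' - r) <= dot c' p] q.
  rewrite ((closure_id _).1 cl); apply: (closureS _ clq); rewrite tubeE => p [s ps] /=.
  have := cauchy_schwarz c' (c' + s *: d - p).
  rewrite !dot_lin c'd mulr0 addr0 -enormE => cs.
  have : enorm c' * enorm (c' + s *: d - p) <= enorm c' * r.
    by rewrite ler_pM2l// ltW// -enormN opprB.
  by rewrite mulrBr -expr2; lra.
rewrite /= => /le_trans/(_ (cauchy_schwarz _ _)); rewrite ler_pM2l// lerBlDr => /le_trans; apply.
by rewrite lerD2r.
Qed.

End Euclid.

(** * Gaps and distances between tubes, and contact with the ball *)

Section Tubes.
Variable R : realType.
Implicit Types (u v x z d c p q : 'cV[R]_3) (a b k s r : R).

(** [a] and [b] solve the normal equations for the nearest points of the two axes; the identity then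
    expresses the squared triple product as a Gram determinant. *)
Lemma common_perpendicular c1 d1 c2 d2 : dot d1 d1 = 1 -> dot d2 d2 = 1 ->
  dot d1 d2 ^+ 2 < 1 -> exists a b, let z := c1 + a *: d1 - (c2 + b *: d2) in
    dot z z * (1 - dot d1 d2 ^+ 2) = dot (c1 - c2) (cross d1 d2) ^+ 2.
Proof.
move=> e1 e2 s1; set s := dot d1 d2.
have S0 : 1 - s ^+ 2 != 0 by rewrite gt_eqF// subr_gt0.
pose w := c1 - c2; pose w1 := dot w d1; pose w2 := dot w d2.
pose a := (s * w2 - w1) / (1 - s ^+ 2); pose b := (w2 - s * w1) / (1 - s ^+ 2).
exists a, b => /=.
have -> : c1 + a *: d1 - (c2 + b *: d2) = w + a *: d1 - b *: d2.
  by apply/matrixP => i j; rewrite !mxE; ring.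
rewrite -/w; move: @w1 @w2 @a @b; move: w => w w1 w2 a b.
have zz : dot (w + a *: d1 - b *: d2) (w + a *: d1 - b *: d2) =
    dot w w + a ^+ 2 + b ^+ 2 + 2 * (a * w1) - 2 * (b * w2) - 2 * (a * b * s).
  rewrite !dot_lin e1 e2 (dotC d1 w) (dotC d2 w) (dotC d2 d1) -/w1 -/w2 -/s; ring.
have gram : dot w (cross d1 d2) ^+ 2 = dot w w * (1 - s ^+ 2) -
    w1 ^+ 2 - w2 ^+ 2 + 2 * (w1 * w2 * s).
  transitivity (dot w w * (dot d1 d1 * dot d2 d2 - s ^+ 2) - w1 ^+ 2 * dot d2 d2 -
    w2 ^+ 2 * dot d1 d1 + 2 * (w1 * w2 * s)); last by rewrite e1 e2; ring.
  by rewrite /w1 /w2 /s !dotE /cross !vec3E; ring.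
by rewrite zz gram /a /b; field.
Qed.

(** A violated inequality forces non-parallel axes, and then the midpoint of their common
    perpendicular lies in both tubes. *)
Lemma disjoint_tubes_gap c1 d1 c2 d2 r : 0 < r -> dot d1 d1 = 1 -> dot d2 d2 = 1 ->
  tube c1 d1 r `&` tube c2 d2 r = set0 ->
  4 * r ^+ 2 * (1 - dot d1 d2 ^+ 2) <= dot (c1 - c2) (cross d1 d2) ^+ 2.
Proof.
move=> r0 e1 e2 dis; rewrite leNgt; apply/negP => lt.
have s1 : dot d1 d2 ^+ 2 < 1.
  have := le_lt_trans (sqr_ge0 _) lt.
  by rewrite pmulr_rgt0 ?subr_gt0// mulr_gt0// exprn_gt0.
have [a [b /= zE]] := common_perpendicular c1 c2 e1 e2 s1.
have [p1 p1E] : {p | p = c1 + a *: d1} by exists (c1 + a *: d1).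
have [p2 p2E] : {p | p = c2 + b *: d2} by exists (c2 + b *: d2).
rewrite -p1E -p2E in zE.
have zr : dot (p1 - p2) (p1 - p2) < 4 * r ^+ 2.
  by rewrite -(@ltr_pM2r _ (1 - dot d1 d2 ^+ 2)) ?subr_gt0// zE.
have : (tube c1 d1 r `&` tube c2 d2 r) ((1 / 2) *: (p1 + p2)).
  split; [exists a; rewrite -p1E|exists b; rewrite -p2E].
    rewrite (_ : _ - p1 = (- (1 / 2)) *: (p1 - p2)); last first.
      by apply/matrixP => i j; rewrite !mxE; field.
    by rewrite enorm_lt// dotZl dotZr; lra.
  rewrite (_ : _ - p2 = (1 / 2) *: (p1 - p2)); last first.
    by apply/matrixP => i j; rewrite !mxE; field.
  by rewrite enorm_lt// dotZl dotZr; lra.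
by rewrite dis.
Qed.

(** A common point gives axis points y and z less than 2 r apart, by the parallelogram law. The
    component of y - z along the common normal is the same for all axis points, so Cauchy-Schwarz
    contradicts the gap. *)
Lemma gap_disjoint_tubes c1 d1 c2 d2 r : 0 < r -> dot d1 d1 = 1 -> dot d2 d2 = 1 ->
  dot d1 d2 ^+ 2 < 1 ->
  4 * r ^+ 2 * (1 - dot d1 d2 ^+ 2) <= dot (c1 - c2) (cross d1 d2) ^+ 2 ->
  tube c1 d1 r `&` tube c2 d2 r = set0.
Proof.
move=> r0 e1 e2 s1 gap; apply/seteqP; split=> // p [[a pa] [b pb]].
pose y := c1 + a *: d1; pose z := c2 + b *: d2.
move: pa pb; rewrite !enorm_lt// -/y -/z => pa pb.
have yz : dot (y - z) (y - z) < 4 * r ^+ 2.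
  have : dot (y - z) (y - z) + dot (p - y + (p - z)) (p - y + (p - z)) =
      2 * dot (p - y) (p - y) + 2 * dot (p - z) (p - z).
    by rewrite !dotE !mxE; ring.
  by have := dot_ge0 (p - y + (p - z)); lra.
have N : dot (y - z) (cross d1 d2) = dot (c1 - c2) (cross d1 d2).
  by rewrite /y /z !dotE /cross !vec3E !mxE; ring.
have NN : dot (cross d1 d2) (cross d1 d2) = 1 - dot d1 d2 ^+ 2.
  by rewrite dot_cross e1 e2 mulr1.
move: gap; rewrite -N -NN => gap.
have := dot_lagrange (y - z) (cross d1 d2).
have := dot_ge0 (cross (y - z) (cross d1 d2)).
have NN0 : 0 < dot (cross d1 d2) (cross d1 d2) by rewrite NN subr_gt0.
have : dot (y - z) (y - z) * dot (cross d1 d2) (cross d1 d2) <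
    4 * r ^+ 2 * dot (cross d1 d2) (cross d1 d2) by rewrite ltr_pM2r.
by lra.
Qed.

Lemma set_dist_ge0 (L M : set 'cV[R]_3) : 0 <= set_dist L M.
Proof.
(* For an empty body the infimum takes its default value 0. *)
rewrite /set_dist; have [->|/set0P ne] := eqVneq [set enorm (p - q) | p in L & q in M] set0.
  by rewrite inf0.
by apply: lb_le_inf => // _ [p _ [q _ <-]]; exact: enorm_ge0.
Qed.

Lemma set_dist_le (L M : set 'cV[R]_3) p q : L p -> M q -> set_dist L M <= enorm (p - q).
Proof.
move=> Lp Mq; apply: ge_inf; last by exists p => //; exists q.
by exists 0 => _ [p' _ [q' _ <-]]; exact: enorm_ge0.
Qed.

Lemma gap_eq_set_dist c1 d1 c2 d2 r : 0 < r -> dot d1 d1 = 1 -> dot d2 d2 = 1 ->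
  dot d1 d2 ^+ 2 < 1 ->
  4 * r ^+ 2 * (1 - dot d1 d2 ^+ 2) = dot (c1 - c2) (cross d1 d2) ^+ 2 ->
  set_dist (tube c1 d1 r) (tube c2 d2 r) = 0.
Proof.
move=> r0 e1 e2 s1 gap; apply/eqP; rewrite eq_le set_dist_ge0 andbT.
have [a [b /= zE]] := common_perpendicular c1 c2 e1 e2 s1.
have [p1 p1E] : {p | p = c1 + a *: d1} by exists (c1 + a *: d1).
have [p2 p2E] : {p | p = c2 + b *: d2} by exists (c2 + b *: d2).
rewrite -p1E -p2E in zE.
have zr : dot (p1 - p2) (p1 - p2) = 4 * r ^+ 2.
  by apply: (@mulIf _ (1 - dot d1 d2 ^+ 2)); rewrite ?zE ?gap// gt_eqF// subr_gt0.
apply/ler_addgt0Pr => e e0; rewrite add0r.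
(* The distance is not attained by open tubes. Moving by slightly less than half of the common
   perpendicular, of length 2 r, stays inside each tube and leaves a gap of 2 r e / (2 r + e) <=
   e. *)
pose k := r / (2 * r + e).
have re : 0 < 2 * r + e by rewrite addr_gt0// mulr_gt0.
have k0 : 0 < k by rewrite divr_gt0.
have k1 : 2 * k < 1 by rewrite mulrA ltr_pdivrMr// mul1r ltrDl.
have kr : (2 * k) ^+ 2 * r ^+ 2 < r ^+ 2.
  rewrite -[ltRHS]mul1r ltr_pM2r ?exprn_gt0// expr_lt1// mulr_ge0// ltW//.
have L1 : tube c1 d1 r (p1 - k *: (p1 - p2)).
  exists a; rewrite -p1E enorm_lt// addrAC subrr add0r dotNl dotNr opprK dotZl dotZr zr.
  by move: kr; lra.
have L2 : tube c2 d2 r (p2 + k *: (p1 - p2)).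
  exists b; rewrite -p2E enorm_lt// addrAC subrr add0r dotZl dotZr zr.
  by move: kr; lra.
apply: le_trans (set_dist_le L1 L2) _.
rewrite (_ : _ - _ = (1 - 2 * k) *: (p1 - p2)); last first.
  by apply/matrixP => i j; rewrite !mxE; ring.
rewrite (enorm_le _ (ltW e0)) dotZl dotZr zr.
have -> : 1 - 2 * k = e / (2 * r + e) by rewrite /k; field; rewrite gt_eqF.
have -> : e / (2 * r + e) * (e / (2 * r + e) * (4 * r ^+ 2)) =
    e ^+ 2 * ((2 * r) / (2 * r + e)) ^+ 2 by field; rewrite gt_eqF.
apply: ler_piMr; first exact: sqr_ge0.
apply: exprn_ile1; first by rewrite divr_ge0 ?mulr_ge0// ltW.
by rewrite ler_pdivrMr// mul1r lerDl ltW.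
Qed.

Lemma set_dist_motion (A : 'M[R]_3) L M : orthogonal_mx A ->
  set_dist [set A *m p | p in L] [set A *m p | p in M] = set_dist L M.
Proof.
move=> AA; rewrite /set_dist; congr inf; apply/seteqP; split.
  move=> _ [_ [p Lp <-] [_ [q Mq <-] <-]]; exists p => //; exists q => //.
  by rewrite -mulmxBr orthogonal_enorm.
move=> _ [p Lp [q Mq <-]]; exists (A *m p); first by exists p.
by exists (A *m q); [exists q|rewrite -mulmxBr orthogonal_enorm].
Qed.

Lemma open_tube c d r : 0 < r -> open (tube c d r).
Proof.
move=> r0.
have -> : tube c d r = \bigcup_s [set p | dot (p - (c + s *: d)) (p - (c + s *: d)) < r ^+ 2].
  apply/seteqP; split=> p; first by move=> [s]; rewrite enorm_lt//; exists s.
  by move=> [s _ /=]; rewrite -enorm_lt//; exists s.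
apply: bigcup_open => s _.
pose sq p := dot (p - (c + s *: d)) (p - (c + s *: d)).
rewrite -[X in open X]/(sq @^-1` [set y | y < r ^+ 2]).
apply: open_comp; last exact: open_lt.
move=> p _; move: p; rewrite /sq.
have E : (fun p => dot (p - (c + s *: d)) (p - (c + s *: d))) =
   fun p => dot (c + s *: d) (c + s *: d) + (- dot (2 *: (c + s *: d)) p +
     (p 0 0 * p 0 0 + p 1 0 * p 1 0 + p 2 0 * p 2 0)).
  by apply/funext => p; rewrite !dotE !mxE; ring.
rewrite E; apply: fctD_continuous; first exact: cst_continuous.
apply: fctD_continuous; first by apply: fctN_continuous; exact: continuous_dot.
by do 2?apply: fctD_continuous; apply: fctM_continuous; exact: coord_continuous.
Qed.

(** Bessel's inequality turns membership in the tube into (1 + r - p . x)^2 < r^2, so p . x > 1. The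
    contact point is [x], the limit of (1 + k) x as k decreases to 0. *)
Lemma touches_ball_tube x d r : 0 < r -> dot x x = 1 -> dot d d = 1 -> dot x d = 0 ->
  touches_ball (tube ((1 + r) *: x) d r).
Proof.
move=> r0 x1 d1 xd; split.
  apply/seteqP; split=> // p [/tubeP-/(_ r0 d1)]; rewrite /open_ball /= enorm_lt//.
  rewrite expr1n => h p1.
  have dx : dot d x = 0 by rewrite dotC.
  have h2 : dot p p - 2 * ((1 + r) * dot p x) + (1 + r) ^+ 2 - dot p d ^+ 2 < r ^+ 2.
    by move: h; rewrite !dot_lin x1 xd (dotC x p); lra.
  have bessel : dot p x ^+ 2 + dot p d ^+ 2 <= dot p p.
    have := dot_ge0 (p - dot p x *: x - dot p d *: d).
    by rewrite !dot_lin x1 d1 xd dx (dotC x p) (dotC d p); lra.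
  have : dot p x < 1.
    by rewrite ltNge; apply/negP => px; have := sqr_ge0 (dot p d); nra.
  move=> px; have : 0 <= (1 - dot p x) ^+ 2 by exact: sqr_ge0.
  have := mulr_gt0 r0 (_ : 0 < 1 - dot p x); rewrite subr_gt0 => /(_ px).
  rewrite !expr2 in h2 bessel *; lra.
exists x; split; last by rewrite /Defs.closed_ball /= enorm_le// x1 expr1n.
move=> B /nbhs_ballP[e /= e0 eB].
pose k := Num.min (e / 2) r.
have k0 : 0 < k by rewrite lt_min r0 divr_gt0.
have kr : k <= r by rewrite ge_min lexx orbT.
have ke : k < e.
  apply: (@le_lt_trans _ _ (e / 2)); first by rewrite ge_min lexx.
  by rewrite ltr_pdivrMr// ltr_pMr// ltr1n.
exists ((1 + k) *: x); split.
  exists 0; rewrite scale0r addr0 -scalerBl enorm_lt// dotZl dotZr x1 mulr1 -expr2.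
  rewrite (_ : 1 + k - (1 + r) = - (r - k)); last by ring.
  rewrite sqrrN ltr_sqr ?nnegrE ?subr_ge0 ?(ltW r0)//.
  by rewrite ltrBlDr ltrDl.
(* Neighbourhoods are those of the sup norm; the entries of the unit vector [x] are at most 1 in
   absolute value. *)
apply: eB; split=> // i j; rewrite /ball /= !mxE.
rewrite (_ : x i j - _ = - (k * x i j)); last by ring.
rewrite normrN normrM gtr0_norm//; apply: le_lt_trans ke.
apply: ler_piMr; first exact: ltW.
rewrite -(@expr_le1 _ 2)// real_normK ?num_real//.
rewrite (ord1 j) -x1 /dot (bigD1 i)//= -expr2 lerDl sumr_ge0// => l _.
by rewrite -expr2 sqr_ge0.
Qed.

End Tubes.


(** * The configuration C_m *)
Section Table.
Variable R : realType.

Local Notation q2 := (Num.sqrt 2 : R).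
Local Notation q3 := (Num.sqrt 3 : R).
Local Notation q5 := (Num.sqrt 5 : R).
Local Notation q11 := (Num.sqrt 11 : R).

Lemma sqrt_nat n : (Num.sqrt n%:R : R) ^+ 2 = n%:R.
Proof. by rewrite sqr_sqrtr// ler0n. Qed.

Lemma sqrt_unique (x y : R) : 0 <= y -> y ^+ 2 = x -> Num.sqrt x = y.
Proof. by move=> y0 <-; rewrite sqrtr_sqr ger0_norm. Qed.

Lemma pi6_values : (cos (pi / 6 : R) = q3 / 2) * (sin (pi / 6 : R) = 1 / 2).
Proof.
have pi0 := pi_gt0 R.
have s0 : 0 < sin (pi / 6 : R).
  by apply: sin_gt0_pi; apply/andP; split; lra.
have c0 : 0 < cos (pi / 6 : R).
  by apply: cos_gt0_pihalf; apply/andP; split; lra.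
(* The double of pi / 6 is its complement, so its sine is the positive root of 2 s^2 + s - 1. *)
have s2 : sin (pi / 6 : R) = 1 - 2 * sin (pi / 6 : R) ^+ 2.
  have E : pi / 6 + pi / 6 = pi / 2 - pi / 6 :> R by field.
  have : cos (pi / 6 + pi / 6 : R) = sin (pi / 6) by rewrite E cosB cos_pihalf sin_pihalf; ring.
  rewrite cosD -!expr2; have := cos2Dsin2 (pi / 6 : R); lra.
have sE : sin (pi / 6 : R) = 1 / 2.
  have : (2 * sin (pi / 6 : R) - 1) * (sin (pi / 6 : R) + 1) = 0 by move: s2; lra.
  by move/eqP; rewrite mulf_eq0 => /orP[|] /eqP; lra.
split=> //; apply/esym; have := cos2Dsin2 (pi / 6 : R); rewrite sE => cE.
rewrite -[RHS]ger0_norm ?ltW// -sqrtr_sqr.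
apply/esym; apply: sqrt_unique; first by rewrite divr_ge0// sqrtr_ge0.
by rewrite expr_div_n sqrt_nat; lra.
Qed.

Lemma phi_values : (sin (phi_m R) = q3 * q11 / 11) * (cos (phi_m R) = 2 * q2 * q11 / 11).
Proof.
have E : Num.sqrt (3 / 11) = q3 * q11 / 11 :> R.
  apply: sqrt_unique; first by rewrite divr_ge0// mulr_ge0// sqrtr_ge0.
  by rewrite expr_div_n exprMn !sqrt_nat; field.
have I : -1 <= (Num.sqrt (3 / 11) : R) <= 1.
  apply/andP; split; first by apply: le_trans (sqrtr_ge0 _); lra.
  by rewrite -[leRHS]sqrtr1 ler_sqrt//; lra.
split; rewrite /phi_m.
  by rewrite asinK ?in_itv.
rewrite cos_asin// E; apply: sqrt_unique.
  by rewrite divr_ge0// !mulr_ge0// sqrtr_ge0.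
by rewrite !expr_div_n !exprMn !sqrt_nat; field.
Qed.

Lemma sin_atan (x : R) : sin (atan x) = x * cos (atan x).
Proof.
have c0 : cos (atan x) != 0.
  by rewrite gt_eqF// cos_gt0_pihalf// atan_gtNpi2 atan_ltpi2.
by rewrite -[X in X * _](atanK x) /tan divfK.
Qed.

Lemma delta_values : (cos (delta_m R) = q11 / 4) * (sin (delta_m R) = q5 / 4).
Proof.
have cE : cos (delta_m R) = q11 / 4.
  rewrite /delta_m cos_atan sqr_sqrtr; last by lra.
  rewrite -sqrtrV; last by lra.
  apply: sqrt_unique; first by rewrite divr_ge0// sqrtr_ge0.
  by rewrite expr_div_n sqrt_nat; field.
split=> //; rewrite /delta_m sin_atan -/(delta_m R) cE mulrA; congr (_ / _).
rewrite -sqrtrM; last by lra.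
by congr Num.sqrt; field.
Qed.

Lemma kappa_values : (cos (kappa_m R) = q3 * q5 / 4) * (sin (kappa_m R) = - (1 / 4)).
Proof.
have E15 : Num.sqrt 15 = q3 * q5 :> R.
  by rewrite -sqrtrM//; congr Num.sqrt; rewrite -natrM.
have n0 : q3 * q5 != 0 by rewrite mulf_neq0// sqrtr_eq0 -ltNge.
have e15 : (1 / (q3 * q5)) ^+ 2 = 1 / 15 :> R.
  by rewrite expr_div_n exprMn !sqrt_nat expr1n -natrM.
have cE : cos (kappa_m R) = q3 * q5 / 4.
  rewrite /kappa_m cosN E15 cos_atan e15 -sqrtrV; last by lra.
  apply: sqrt_unique; first by rewrite divr_ge0// mulr_ge0// sqrtr_ge0.
  by rewrite expr_div_n exprMn !sqrt_nat; field.
split=> //; rewrite /kappa_m sinN sin_atan; congr (- _).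
rewrite -[cos (atan _)]cosN -/(kappa_m R) cE E15.
by field; move: n0; rewrite mulf_eq0 negb_or => /andP[-> ->].
Qed.

Lemma up_lineE cw (lat lon delta : R) : up_line cw lat lon delta =
  (vec3 (cos lat * cos lon) (cos lat * sin lon) (sin lat),
   vec3 (- (cos delta * (sin lat * cos lon)) + (-1) ^+ cw * (sin delta * sin lon))
        (- (cos delta * (sin lat * sin lon)) - (-1) ^+ cw * (sin delta * cos lon))
        (cos delta * cos lat)).
Proof.
rewrite /up_line /rotate.
have [c2 s2] := (cos2Dsin2 lat, cos2Dsin2 lon).
have -> : dot (sphere_point lat lon) (north lat lon) = 0.
  rewrite dotE /sphere_point /north !vec3E.
  transitivity (sin lat * cos lat * (1 - (cos lon ^+ 2 + sin lon ^+ 2))); first by ring.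
  by rewrite s2; ring.
have -> : cross (sphere_point lat lon) (north lat lon) = vec3 (sin lon) (- cos lon) 0.
  apply: col3P; rewrite /cross /sphere_point /north !vec3E.
  - by rewrite -[RHS]mul1r -c2; ring.
  - by rewrite -[RHS]mul1r -c2; ring.
  - by ring.
have -> : cos ((-1) ^+ cw * delta) = cos delta.
  by case: cw; rewrite ?mul1r// mulN1r cosN.
have -> : sin ((-1) ^+ cw * delta) = (-1) ^+ cw * sin delta.
  by case: cw; rewrite ?mul1r// !mulN1r sinN.
by congr pair; apply: col3P; rewrite /north !mxE /=; ring.
Qed.

Definition emb (v : vec R) : 'cV[R]_3 := vec3 (v1 v) (q3 * v2 v) (q2 * q3 * v3 v).

Lemma dot_emb v w : dot (emb v) (emb w) = wdot v w.
Proof.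
rewrite dotE /emb !vec3E /wdot.
transitivity (v1 v * v1 w + q3 ^+ 2 * (v2 v * v2 w) + q2 ^+ 2 * q3 ^+ 2 * (v3 v * v3 w)).
  by ring.
by rewrite !sqrt_nat; ring.
Qed.

Let k1 := q2 * q11 / 44.
Let k2 := q3 / 24.

Let longitudes := (pi6_values, cosB, sinB, cosD, sinD, cosN, sinN,
  cospi, sinpi, cos_pihalf, sin_pihalf).

Let latitudes := (phi_values, delta_values, cosN, sinN).

Lemma C_mE (i : 'I_6) : tnth (C_m R true) i =
  (k1 *: emb (fpt (base_frame q5 i)), k2 *: emb (ldir (faxis (base_frame q5 i)))).
Proof.
have [e2 e3 e5] := And3 (sqrt_nat 2) (sqrt_nat 3) (sqrt_nat 5); have e11 := sqrt_nat 11.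
case: i => [[|[|[|[|[|[|//]]]]]] Hi]; rewrite (tnth_nth (0, 0)) /= up_lineE;
  have [ck sk] := kappa_values; move: (kappa_m R) ck sk => k ck sk.
- rewrite !(ck, sk, longitudes, latitudes) /=.
  by congr pair; apply: col3P; rewrite !mxE /= /k1 /k2;
    move: q2 q3 q5 q11 e2 e3 e5 e11 => a b c d e2 e3 e5 e11; field: e2 e3 e5 e11.
- rewrite (_ : 5 * pi / 6 = pi - pi / 6); last by field.
  rewrite !(ck, sk, longitudes, latitudes) /=.
  by congr pair; apply: col3P; rewrite !mxE /= /k1 /k2;
    move: q2 q3 q5 q11 e2 e3 e5 e11 => a b c d e2 e3 e5 e11; field: e2 e3 e5 e11.
- rewrite (_ : 3 * pi / 2 = pi + pi / 2); last by field.
  rewrite !(ck, sk, longitudes, latitudes) /=.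
  by congr pair; apply: col3P; rewrite !mxE /= /k1 /k2;
    move: q2 q3 q5 q11 e2 e3 e5 e11 => a b c d e2 e3 e5 e11; field: e2 e3 e5 e11.
- rewrite !(ck, sk, longitudes, latitudes) /=.
  by congr pair; apply: col3P; rewrite !mxE /= /k1 /k2;
    move: q2 q3 q5 q11 e2 e3 e5 e11 => a b c d e2 e3 e5 e11; field: e2 e3 e5 e11.
- rewrite (_ : 7 * pi / 6 = pi + pi / 6); last by field.
  rewrite !(ck, sk, longitudes, latitudes) /=.
  by congr pair; apply: col3P; rewrite !mxE /= /k1 /k2;
    move: q2 q3 q5 q11 e2 e3 e5 e11 => a b c d e2 e3 e5 e11; field: e2 e3 e5 e11.
- rewrite (_ : 11 * pi / 6 = pi + (pi - pi / 6)); last by field.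
  rewrite !(ck, sk, longitudes, latitudes) /=.
  by congr pair; apply: col3P; rewrite !mxE /= /k1 /k2;
    move: q2 q3 q5 q11 e2 e3 e5 e11 => a b c d e2 e3 e5 e11; field: e2 e3 e5 e11.
Qed.


(* For the other sense of rotation the cylinders at A and D overlap. *)
Lemma C_m_ccwE : (tnth (C_m R false) (inord 0) = (k1 *: emb (fpt (base_frame q5 0)),
    k2 *: emb (Vec ((9 - 3 * q5) / 2) (- ((9 + q5) / 2)) 4))) *
  (tnth (C_m R false) (inord 3) = (k1 *: emb (fpt (base_frame q5 3)), k2 *: emb (Vec 9 q5 4))).
Proof.
have [e2 e3 e5] := And3 (sqrt_nat 2) (sqrt_nat 3) (sqrt_nat 5); have e11 := sqrt_nat 11.
have [ck sk] := kappa_values.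
split; rewrite (tnth_nth (0, 0)) inordK//= up_lineE; move: (kappa_m R) ck sk => k ck sk.
- rewrite !(ck, sk, longitudes, latitudes) /=.
  by congr pair; apply: col3P; rewrite !mxE /= /k1 /k2;
    move: q2 q3 q5 q11 e2 e3 e5 e11 => a b c d e2 e3 e5 e11; field: e2 e3 e5 e11.
- rewrite !(ck, sk, longitudes, latitudes) /=.
  by congr pair; apply: col3P; rewrite !mxE /= /k1 /k2;
    move: q2 q3 q5 q11 e2 e3 e5 e11 => a b c d e2 e3 e5 e11; field: e2 e3 e5 e11.
Qed.

Let k3 := q3 * q11 / 264.

Definition base_pt (i : nat) : 'cV[R]_3 := k1 *: emb (fpt (base_frame q5 i)).
Definition base_dir (i : nat) : 'cV[R]_3 := k2 *: emb (ldir (faxis (base_frame q5 i))).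
Definition base_nor (i : nat) : 'cV[R]_3 := k3 *: emb (lnor (faxis (base_frame q5 i))).

Lemma embD v w : emb (vadd v w) = emb v + emb w.
Proof. by apply: col3P; rewrite /emb !mxE /=; ring. Qed.

Lemma embZ a v : emb (vscale a v) = a *: emb v.
Proof. by apply: col3P; rewrite /emb !mxE /=; ring. Qed.

Lemma radicals_neq0 : (q2 != 0) * (q3 != 0) * (q5 != 0) * (q11 != 0).
Proof. by do !split; rewrite sqrtr_eq0 -ltNge ltr0n. Qed.

Lemma emb_perturb_dir i (u w p g e f : R) :
  k2 *: emb (ldir (perturb (base_frame q5 i) u w p g e f)) =
  (q2 * q3 * q11 * u) *: base_pt i + (1 - e) *: base_dir i + (2 * q11 * w) *: base_nor i.
Proof.
have [e2 e3 e11] := And3 (sqrt_nat 2) (sqrt_nat 3) (sqrt_nat 11).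
rewrite /base_pt /base_dir /base_nor; case: (base_frame q5 i) => [x [X m]] /=.
rewrite !embD !embZ /k1 /k2 /k3; move: (emb x) (emb X) (emb m) => x' X' m'.
move: q2 q3 q11 e2 e3 e11 => a b c e2 e3 e11.
by apply: col3P; rewrite !mxE; field: e2 e3 e11.
Qed.

Lemma emb_perturb_nor i (u w p g e f : R) :
  k3 *: emb (lnor (perturb (base_frame q5 i) u w p g e f)) =
  (2 * q2 * q3 * p) *: base_pt i - (2 * q11 * g) *: base_dir i + (1 - f) *: base_nor i.
Proof.
have [e2 e3 e11] := And3 (sqrt_nat 2) (sqrt_nat 3) (sqrt_nat 11).
rewrite /base_pt /base_dir /base_nor; case: (base_frame q5 i) => [x [X m]] /=.
rewrite !embD !embZ /k1 /k2 /k3; move: (emb x) (emb X) (emb m) => x' X' m'.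
move: q2 q3 q11 e2 e3 e11 => a b c e2 e3 e11.
by apply: col3P; rewrite !mxE; field: e2 e3 e11.
Qed.

Lemma clear_emb (a b : line R) :
  level R * (dot (k2 *: emb (ldir a)) (k2 *: emb (ldir b)) ^+ 2 +
    11 / 12 * (dot (k3 *: emb (lnor a)) (k2 *: emb (ldir b)) +
               dot (k3 *: emb (lnor b)) (k2 *: emb (ldir a))) ^+ 2) = clearance a b.
Proof.
have [e3 e11] := (sqrt_nat 3, sqrt_nat 11).
rewrite !dotZl !dotZr !dot_emb levelE /clearance /ldot /lmom /k2 /k3.
have -> : wdot (lnor b) (ldir a) = wdot (ldir a) (lnor b) by rewrite /wdot; ring.
move: (wdot _ _) (wdot _ _) (wdot _ _) => x y z.
by move: q3 q11 e3 e11 => c d e3 e11; field: e3 e11.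
Qed.

Lemma cross_base i : cross (base_pt i) (base_dir i) = base_nor i.
Proof.
have [e2 e3 e5] := And3 (sqrt_nat 2) (sqrt_nat 3) (sqrt_nat 5); have e11 := sqrt_nat 11.
rewrite /base_pt /base_dir /base_nor /k1 /k2 /k3 /cross /emb.
move: q2 q3 q5 q11 e2 e3 e5 e11 => a b c d e2 e3 e5 e11.
by do 5?[case: i => [|i]]; apply: col3P; rewrite !mxE /=; field: e2 e3 e5 e11.
Qed.

Lemma base_orthonormal i :
  (dot (base_pt i) (base_pt i) = 1) * (dot (base_dir i) (base_dir i) = 1) *
  (dot (base_pt i) (base_dir i) = 0).
Proof.
have [e2 e3 e5] := And3 (sqrt_nat 2) (sqrt_nat 3) (sqrt_nat 5); have e11 := sqrt_nat 11.
rewrite /base_pt /base_dir !dotZl !dotZr !dot_emb /k1 /k2 /wdot.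
move: q2 q3 q5 q11 e2 e3 e5 e11 => a b c d e2 e3 e5 e11.
by do 5?[case: i => [|i]]; do !split; rewrite /=; field: e2 e3 e5 e11.
Qed.

Lemma r_m_gt0 : 0 < r_m R.
Proof. by rewrite divr_gt0// ltr_wpDr// sqrtr_ge0. Qed.

(** [r_m] is the positive root of 8 r^2 - 6 r - 3, to which this equation reduces. *)
Lemma r_mE : 12 * (1 + r_m R) ^+ 2 = 44 * r_m R ^+ 2.
Proof. by have e := sqrt_nat 33; rewrite /r_m; field: e. Qed.

End Table.

(** * Moving frames *)

Section Frames.
Variable R : realType.
Implicit Types (u v x d n y e : 'cV[R]_3).

Definition orthonormal x d := [/\ dot x x = 1, dot d d = 1 & dot x d = 0].

Lemma cross_cross u v x : cross u (cross v x) = dot u x *: v - dot u v *: x.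
Proof. by apply: col3P; rewrite /cross !dotE !mxE /=; ring. Qed.

Lemma crossC u v : cross u v = - cross v u.
Proof. by apply: col3P; rewrite /cross !mxE /=; ring. Qed.

Lemma dot_cross_l u v : dot u (cross u v) = 0.
Proof. by rewrite dotE /cross !mxE /=; ring. Qed.

Lemma dot_cross_r u v : dot v (cross u v) = 0.
Proof. by rewrite dotE /cross !mxE /=; ring. Qed.

Lemma crossD u v x : cross (u + v) x = cross u x + cross v x.
Proof. by apply: col3P; rewrite /cross !mxE /=; ring. Qed.

Lemma crossZ (a : R) u x : cross (a *: u) x = a *: cross u x.
Proof. by apply: col3P; rewrite /cross !mxE /=; ring. Qed.

Lemma crossDr u v x : cross x (u + v) = cross x u + cross x v.
Proof. by rewrite crossC crossD opprD -!(crossC x). Qed.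

Lemma crossZr (a : R) u x : cross x (a *: u) = a *: cross x u.
Proof. by rewrite crossC crossZ -scalerN -crossC. Qed.

Lemma crossvv u : cross u u = 0.
Proof. by apply: col3P; rewrite /cross !mxE /=; ring. Qed.

Lemma orthonormal_nor x d : orthonormal x d -> dot (cross x d) (cross x d) = 1.
Proof. by move=> [x1 d1 xd]; rewrite dot_cross x1 d1 xd; ring. Qed.

Lemma orthonormal_expand x d v : orthonormal x d ->
  v = dot v x *: x + dot v d *: d + dot v (cross x d) *: cross x d.
Proof.
move=> xd; have n1 := orthonormal_nor xd; have [x1 d1 xd0] := xd.
have dx0 : dot d x = 0 by rewrite dotC.
set n := cross x d in n1 *.
have [xn dn] : dot x n = 0 /\ dot d n = 0 by rewrite dot_cross_l dot_cross_r.
have [nx nd] : dot n x = 0 /\ dot n d = 0 by rewrite !(dotC n).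
apply/eqP; rewrite -subr_eq0; apply/eqP.
have [z zE] : {z | z = v - (dot v x *: x + dot v d *: d + dot v n *: n)} by eexists.
have zx : dot z x = 0 by rewrite zE !(dotDl, dotNl, dotZl) x1 dx0 nx; ring.
have zd : dot z d = 0 by rewrite zE !(dotDl, dotNl, dotZl) d1 xd0 nd; ring.
have zn : dot z n = 0 by rewrite zE !(dotDl, dotNl, dotZl) n1 xn dn; ring.
rewrite -zE; apply: dot_eq0; have := dot_lagrange z n.
rewrite n1 mulr1 zn expr0n add0r => ->.
by rewrite /n cross_cross zx zd !scale0r subr0 dotE !mxE; ring.
Qed.

Lemma parseval x d u v : orthonormal x d -> dot u v =
  dot u x * dot v x + dot u d * dot v d + dot u (cross x d) * dot v (cross x d).
Proof.
move=> xd; rewrite {1}(orthonormal_expand v xd) !dotDr !dotZr; ring.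
Qed.

Lemma orthonormal_cross_dn x d : orthonormal x d -> cross d (cross x d) = x.
Proof.
by move=> [_ d1 xd]; rewrite cross_cross d1 (dotC d) xd scale1r scale0r subr0.
Qed.

Lemma orthonormal_cross_nx x d : orthonormal x d -> cross (cross x d) x = d.
Proof.
move=> [x1 _ xd]; rewrite crossC cross_cross x1 xd scale1r scale0r sub0r opprK//.
Qed.

Lemma cross_expand x d (a b c a' b' c' : R) : orthonormal x d ->
  cross (a *: x + b *: d + c *: cross x d) (a' *: x + b' *: d + c' *: cross x d) =
  (b * c' - c * b') *: x + (c * a' - a * c') *: d + (a * b' - b * a') *: cross x d.
Proof.
move=> xd; have [dn nx] := (orthonormal_cross_dn xd, orthonormal_cross_nx xd).
have [nd xn] : cross (cross x d) d = - x /\ cross x (cross x d) = - d.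
  by rewrite crossC dn (crossC x) nx.
have dx : cross d x = - cross x d by rewrite crossC.
have [n nE] : {n | n = cross x d} by eexists.
rewrite -nE in dn nx nd xn dx *.
rewrite !(crossD, crossZ, crossDr, crossZr) !crossvv dn nx nd xn dx -nE.
by apply/matrixP => i j; rewrite !mxE; ring.
Qed.

Lemma det3E (A : 'M[R]_3) : \det A = dot (col 0 A) (cross (col 1 A) (col 2 A)).
Proof.
rewrite (expand_det_col _ 0) !big_ord_recl big_ord0 /cofactor.
rewrite !(expand_det_col _ 0) !big_ord_recl !big_ord0 /cofactor !det_mx11 !mxE /=.
rewrite dotE /cross !mxE /=.
(* Indexing by naturals identifies the different ordinal terms produced by the nested cofactor
   expansions. *)
pose a (i j : nat) := A (inord i) (inord j).
have aE i j : A i j = a i j by rewrite /a !inord_val.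
by rewrite !aE /= /bump /= !add0n !addn0 !expr0 !expr1; ring.
Qed.

Lemma orthogonal_mx_dot (A : 'M[R]_3) :
  (forall u v, dot (A *m u) (A *m v) = dot u v) -> orthogonal_mx A.
Proof.
have gram (B : 'M[R]_3) i j :
    (B^T *m B) i j = dot (B *m delta_mx i 0) (B *m delta_mx j 0).
  by rewrite mxE /dot -!colE; apply: eq_bigr => k _; rewrite !mxE.
move=> AA; apply/matrixP => i j.
by rewrite gram AA -[delta_mx i 0]mul1mx -[delta_mx j 0]mul1mx -gram trmx1 mul1mx.
Qed.

Variables (x0 d0 : 'cV[R]_3).
Hypothesis o0 : orthonormal x0 d0.

Definition frame_map x d : 'M[R]_3 :=
  x *m x0^T + d *m d0^T + cross x d *m (cross x0 d0)^T.

Lemma frame_mapE x d v : frame_map x d *m v =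
  dot v x0 *: x + dot v d0 *: d + dot v (cross x0 d0) *: cross x d.
Proof.
have E (y z : 'cV[R]_3) : z *m y^T *m v = dot v y *: z.
  rewrite -mulmxA; apply/matrixP => i j; rewrite (ord1 j) !mxE big_ord1 !mxE mulrC.
  by congr (_ * _); apply: eq_bigr => k _; rewrite mxE mulrC.
by rewrite /frame_map !mulmxDl !E.
Qed.

Variables (x d : 'cV[R]_3).
Hypothesis o : orthonormal x d.

Lemma frame_map_dot u v : dot (frame_map x d *m u) (frame_map x d *m v) = dot u v.
Proof.
have [x1 d1 xd] := o; have n1 := orthonormal_nor o; have dx : dot d x = 0 by rewrite dotC.
have [xn dn] : dot x (cross x d) = 0 /\ dot d (cross x d) = 0.
  by rewrite dot_cross_l dot_cross_r.
have [nx nd] : dot (cross x d) x = 0 /\ dot (cross x d) d = 0 by rewrite !(dotC (cross x d)).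
rewrite !frame_mapE (parseval u v o0).
by rewrite !(dotDl, dotZl, dotDr, dotZr) x1 d1 n1 xd dx xn dn nx nd; ring.
Qed.

Lemma frame_map_orthogonal : orthogonal_mx (frame_map x d).
Proof. exact: orthogonal_mx_dot frame_map_dot. Qed.

Lemma frame_map_cross u v :
  cross (frame_map x d *m u) (frame_map x d *m v) = frame_map x d *m cross u v.
Proof.
rewrite !frame_mapE cross_expand//.
have [x01 d01 x0d0] := o0; have n01 := orthonormal_nor o0.
have d0x0 : dot d0 x0 = 0 by rewrite dotC.
have [x0n d0n] : dot x0 (cross x0 d0) = 0 /\ dot d0 (cross x0 d0) = 0.
  by rewrite dot_cross_l dot_cross_r.
have [nx0 nd0] : dot (cross x0 d0) x0 = 0 /\ dot (cross x0 d0) d0 = 0.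
  by rewrite !(dotC (cross x0 d0)).
have -> : cross u v = (dot u d0 * dot v (cross x0 d0) - dot u (cross x0 d0) * dot v d0) *: x0 +
    (dot u (cross x0 d0) * dot v x0 - dot u x0 * dot v (cross x0 d0)) *: d0 +
    (dot u x0 * dot v d0 - dot u d0 * dot v x0) *: cross x0 d0.
  by rewrite -cross_expand// -!orthonormal_expand.
move: (dot u _) (dot u _) (dot u _) (dot v _) (dot v _) (dot v _) => a b c a' b' c'.
rewrite !(dotDl, dotZl) x01 d01 n01 x0d0 d0x0 x0n d0n nx0 nd0.
by rewrite !(mulr0, mulr1, addr0, add0r).
Qed.

(** Dot and cross products are preserved, so the triple product of the columns equals that of the
    standard basis, namely 1. *)
Lemma frame_map_SO3 : SO3 (frame_map x d).
Proof.
split; first exact: frame_map_orthogonal.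
rewrite det3E !colE frame_map_cross frame_map_dot.
by rewrite dotE /cross !mxE /=; ring.
Qed.

Lemma frame_map_pt : frame_map x d *m x0 = x.
Proof.
have [x01 d01 x0d0] := o0.
by rewrite frame_mapE x01 x0d0 dot_cross_l scale1r !scale0r !addr0.
Qed.

Lemma frame_map_dir : frame_map x d *m d0 = d.
Proof.
have [x01 d01 x0d0] := o0.
by rewrite frame_mapE d01 (dotC d0) x0d0 dot_cross_r scale1r !scale0r addr0 add0r.
Qed.

End Frames.

(** * Gauge fixing and global rigidity of a continuous family of frames *)

Section RigidFrames.
Variable R : realType.

Local Notation q2 := (Num.sqrt 2 : R).
Local Notation q3 := (Num.sqrt 3 : R).
Local Notation q5 := (Num.sqrt 5 : R).
Local Notation q11 := (Num.sqrt 11 : R).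

Definition vcontinuous (f : R -> 'cV[R]_3) : Prop :=
  forall a, continuous (fun t => f t a 0).

Lemma dot_continuous f g : vcontinuous f -> vcontinuous g ->
  continuous (fun t => dot (f t) (g t)).
Proof. by move=> cf cg; apply: fct_sum_continuous => a; exact: fctM_continuous. Qed.

Lemma vcontinuousZ (k : R -> R) f : continuous k -> vcontinuous f ->
  vcontinuous (fun t => k t *: f t).
Proof.
move=> ck cf a; rewrite (_ : (fun _ => _) = fun t => k t * f t a 0).
  exact: fctM_continuous.
by apply/funext => t; rewrite mxE.
Qed.

Lemma vcontinuousD f g : vcontinuous f -> vcontinuous g -> vcontinuous (fun t => f t + g t).
Proof.
move=> cf cg a; rewrite (_ : (fun _ => _) = fun t => f t a 0 + g t a 0).
  exact: fctD_continuous.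
by apply/funext => t; rewrite mxE.
Qed.

Lemma vcontinuous_cross f g : vcontinuous f -> vcontinuous g ->
  vcontinuous (fun t => cross (f t) (g t)).
Proof.
move=> cf cg a.
have cB (h k h' k' : R -> R) : continuous h -> continuous k -> continuous h' ->
    continuous k' -> continuous (fun t => h t * k t - h' t * k' t).
  move=> ch ck ch' ck'; apply: fctD_continuous; first exact: fctM_continuous.
  by apply: fctN_continuous; exact: fctM_continuous.
case: a => [[|[|[|//]]]] Ha.
- rewrite (_ : (fun _ => _) = fun t => f t 1 0 * g t 2 0 - f t 2 0 * g t 1 0); first exact: cB.
  by apply/funext => t; rewrite /cross mxE.
- rewrite (_ : (fun _ => _) = fun t => f t 2 0 * g t 0 0 - f t 0 0 * g t 2 0); first exact: cB.
  by apply/funext => t; rewrite /cross mxE.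
- rewrite (_ : (fun _ => _) = fun t => f t 0 0 * g t 1 0 - f t 1 0 * g t 0 0); first exact: cB.
  by apply/funext => t; rewrite /cross mxE.
Qed.

(** The reciprocal product of two lines in Plücker coordinates, that is, the triple product (x - y)
    . (d cross e). *)
Definition skew (x d y e : 'cV[R]_3) : R := dot (cross x d) e + dot (cross y e) d.

Variables x d : nat -> R -> 'cV[R]_3.
Hypothesis xd_orthonormal : forall i t, orthonormal (x i t) (d i t).
Hypothesis x0E : forall i, (i < 6)%N -> x i 0 = base_pt R i.
Hypothesis d0E : forall i, (i < 6)%N -> d i 0 = base_dir R i.
Hypothesis x_continuous : forall i, vcontinuous (x i).
Hypothesis d_continuous : forall i, vcontinuous (d i).
Hypothesis gap : forall k t, (k < 12)%N ->
  let: (i, j) := contact k in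
  1 - dot (d i t) (d j t) ^+ 2 <= 11 / 12 * skew (x i t) (d i t) (x j t) (d j t) ^+ 2.

(* The rotation carrying line A of the initial configuration to line A at time t;
   undoing it fixes A and thereby removes the SO(3) freedom. *)
Definition gauge (t : R) : 'M[R]_3 := frame_map (base_pt R 0) (base_dir R 0) (x 0 t) (d 0 t).

Let base_on i : orthonormal (base_pt R i) (base_dir R i).
Proof. by split; rewrite base_orthonormal. Qed.

Let gauge_dot t v w : dot (gauge t *m v) (gauge t *m w) = dot v w.
Proof. exact: frame_map_dot. Qed.

Let gauge_on i t : orthonormal (gauge t *m base_pt R i) (gauge t *m base_dir R i).
Proof. by split; rewrite gauge_dot base_orthonormal. Qed.

Let gauge_nor i t : cross (gauge t *m base_pt R i) (gauge t *m base_dir R i) =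
  gauge t *m base_nor R i.
Proof. by rewrite frame_map_cross// cross_base. Qed.

Let n i t := cross (x i t) (d i t).

(** Coordinates of the moved direction and normal in the rotated base frame, divided by the radicals
    of [emb_perturb_dir] and [emb_perturb_nor] so that they are the arguments of [perturb]. *)
Definition gauge_u i t := dot (d i t) (gauge t *m base_pt R i) / (q2 * q3 * q11).
Definition gauge_w i t := dot (d i t) (gauge t *m base_nor R i) / (2 * q11).
Definition gauge_e i t := 1 - dot (d i t) (gauge t *m base_dir R i).
Definition gauge_p i t := dot (n i t) (gauge t *m base_pt R i) / (2 * q2 * q3).
Definition gauge_g i t := - dot (n i t) (gauge t *m base_dir R i) / (2 * q11).
Definition gauge_f i t := 1 - dot (n i t) (gauge t *m base_nor R i).

Let du i t : dot (d i t) (gauge t *m base_pt R i) = q2 * q3 * q11 * gauge_u i t.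
Proof. by rewrite /gauge_u mulrC divfK// !mulf_neq0// radicals_neq0. Qed.
Let dw i t : dot (d i t) (gauge t *m base_nor R i) = 2 * q11 * gauge_w i t.
Proof. by rewrite /gauge_w mulrC divfK// !mulf_neq0// ?radicals_neq0// pnatr_eq0. Qed.
Let de i t : dot (d i t) (gauge t *m base_dir R i) = 1 - gauge_e i t.
Proof. by rewrite /gauge_e subKr. Qed.
Let np i t : dot (n i t) (gauge t *m base_pt R i) = 2 * q2 * q3 * gauge_p i t.
Proof. by rewrite /gauge_p mulrC divfK// !mulf_neq0// ?radicals_neq0// pnatr_eq0. Qed.
Let ng i t : dot (n i t) (gauge t *m base_dir R i) = - (2 * q11 * gauge_g i t).
Proof.
by rewrite /gauge_g mulNr mulrN opprK mulrC divfK// !mulf_neq0// ?radicals_neq0// pnatr_eq0.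
Qed.
Let nf i t : dot (n i t) (gauge t *m base_nor R i) = 1 - gauge_f i t.
Proof. by rewrite /gauge_f subKr. Qed.

Let sqE := (sqrt_nat R 2, sqrt_nat R 3, sqrt_nat R 11).

(** Parseval's identity for the unit direction; the next two lemmas apply it to the normal and to
    the pair of both. *)
Lemma gauge_eE i t : 2 * gauge_e i t =
  66 * gauge_u i t ^+ 2 + 44 * gauge_w i t ^+ 2 + gauge_e i t ^+ 2.
Proof.
have [_ d1 _] := xd_orthonormal i t.
have := parseval (d i t) (d i t) (gauge_on i t).
rewrite gauge_nor d1 du dw de => E.
have : 1 = q2 ^+ 2 * q3 ^+ 2 * q11 ^+ 2 * gauge_u i t ^+ 2 +
    (1 - gauge_e i t) ^+ 2 + 4 * q11 ^+ 2 * gauge_w i t ^+ 2 by rewrite {1}E; ring.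
by rewrite !sqE; lra.
Qed.

Lemma gauge_fE i t : 2 * gauge_f i t =
  24 * gauge_p i t ^+ 2 + 44 * gauge_g i t ^+ 2 + gauge_f i t ^+ 2.
Proof.
have n1 := orthonormal_nor (xd_orthonormal i t).
have := parseval (n i t) (n i t) (gauge_on i t).
rewrite gauge_nor {1 2}/n n1 np ng nf => E.
have : 1 = 4 * (q2 ^+ 2 * q3 ^+ 2) * gauge_p i t ^+ 2 +
    (1 - gauge_f i t) ^+ 2 + 4 * q11 ^+ 2 * gauge_g i t ^+ 2 by rewrite {1}E; ring.
by rewrite !sqE; lra.
Qed.

Lemma gauge_gE i t : (1 - gauge_e i t) * gauge_g i t =
  gauge_w i t * (1 - gauge_f i t) + 6 * (gauge_u i t * gauge_p i t).
Proof.
have dn0 : dot (d i t) (n i t) = 0 by exact: dot_cross_r.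
have := parseval (d i t) (n i t) (gauge_on i t).
rewrite gauge_nor dn0 du dw de np ng nf => E.
have : 0 = q11 * (2 * (q2 ^+ 2 * q3 ^+ 2) * (gauge_u i t * gauge_p i t) -
    2 * ((1 - gauge_e i t) * gauge_g i t) + 2 * (gauge_w i t * (1 - gauge_f i t))).
  by rewrite {1}E; ring.
rewrite !sqE => /esym/eqP; rewrite mulf_eq0 (negPf (radicals_neq0 R).2) /= => /eqP.
by lra.
Qed.

Local Notation moved_lines :=
  (moved_lines q5 gauge_u gauge_w gauge_p gauge_g gauge_e gauge_f).

Lemma gauge_linesE i t :
  (gauge t *m ((q3 / 24) *: emb (ldir (moved_lines t i))) = d i t) *
  (gauge t *m ((q3 * q11 / 264) *: emb (lnor (moved_lines t i))) = n i t).
Proof.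
split; rewrite /moved_lines ?emb_perturb_dir ?emb_perturb_nor.
  rewrite [RHS](orthonormal_expand _ (gauge_on i t)) gauge_nor du dw de.
  by rewrite !mulmxDr -!scalemxAr.
rewrite [RHS](orthonormal_expand _ (gauge_on i t)) gauge_nor np ng nf.
by rewrite !mulmxDr mulmxN -!scalemxAr scaleNr.
Qed.

Lemma gauge_clear k t : (k < 12)%N -> level R <= cclearance (moved_lines t) k.
Proof.
move=> k12; rewrite /cclearance; case: (contact k) (gap t k12) => i j /= gp.
have dd : dot ((q3 / 24) *: emb (ldir (moved_lines t i))) ((q3 / 24) *: emb (ldir (moved_lines t j))) =
    dot (d i t) (d j t) by rewrite -(gauge_dot t) !gauge_linesE.
have nd a b : dot ((q3 * q11 / 264) *: emb (lnor (moved_lines t a)))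
    ((q3 / 24) *: emb (ldir (moved_lines t b))) = dot (n a t) (d b t).
  by rewrite -(gauge_dot t) !gauge_linesE.
rewrite -clear_emb dd !nd.
rewrite -[leLHS]mulr1 ler_wpM2l//; first by rewrite levelE sqr_ge0.
by rewrite addrC -lerBlDr.
Qed.

Lemma deviation_gauge_continuous :
  continuous (deviation gauge_u gauge_w gauge_p gauge_g gauge_e gauge_f).
Proof.
have cG v : vcontinuous (fun t => gauge t *m v).
  rewrite (_ : (fun _ => _) = fun t => dot v (base_pt R 0) *: x 0 t +
      dot v (base_dir R 0) *: d 0 t + dot v (cross (base_pt R 0) (base_dir R 0)) *: n 0 t).
    apply: vcontinuousD; first apply: vcontinuousD; apply: vcontinuousZ => //;
      try exact: cst_continuous.
    exact: vcontinuous_cross.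
  by apply/funext => t; rewrite /gauge frame_mapE.
have cn i : vcontinuous (n i) by exact: vcontinuous_cross.
have cdiv (h : R -> R) (k : R) : continuous h -> continuous (fun t => h t / k).
  by move=> ch; apply: fctM_continuous => //; exact: cst_continuous.
have c1B (h : R -> R) : continuous h -> continuous (fun t => 1 - h t).
  move=> ch; apply: fctD_continuous; first exact: cst_continuous.
  exact: fctN_continuous.
apply: fct_sum_continuous => i.
rewrite /deviation1; repeat (apply: fctD_continuous); apply: fct_norm_continuous.
- by apply: cdiv; exact: dot_continuous.
- by apply: cdiv; exact: dot_continuous.
- by apply: cdiv; exact: dot_continuous.
- by apply: cdiv; apply: fctN_continuous; exact: dot_continuous.
- by apply: c1B; exact: dot_continuous.
- by apply: c1B; exact: dot_continuous.
Qed.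

Lemma deviation_gauge0 : deviation gauge_u gauge_w gauge_p gauge_g gauge_e gauge_f 0 = 0.
Proof.
have G1 (v : 'cV[R]_3) : gauge 0 *m v = v.
  by rewrite /gauge frame_mapE x0E// d0E// -orthonormal_expand.
apply: big1 => i _; have i6 := ltn_ord i; have [x1 d1 xd] := base_on i.
have n1 := orthonormal_nor (base_on i).
rewrite /deviation1 /gauge_u /gauge_w /gauge_p /gauge_g /gauge_e /gauge_f !G1 /n.
rewrite x0E// d0E// -!cross_base.
rewrite (dotC (base_dir R i) (base_pt R i)) xd dot_cross_r d1 n1.
rewrite !(dotC (cross _ _)) dot_cross_l dot_cross_r.
by rewrite !(oppr0, mul0r, subrr, normr0, addr0).
Qed.

Theorem rigid_frames t i : (i < 6)%N ->
  (x i t = gauge t *m base_pt R i) * (d i t = gauge t *m base_dir R i).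
Proof.
pose sz := deviation gauge_u gauge_w gauge_p gauge_g gauge_e gauge_f.
have [eps eps0 epsP] : exists2 eps : R, 0 < eps & forall t, sz t < eps -> sz t = 0.
  apply: (local_rigidity (s5 := q5)).
  - exact: sqrt_nat.
  - exact: sqrtr_ge0.
  - move=> s; rewrite /gauge_u /gauge (frame_map_pt (base_on 0)).
    by have [_ _ xd] := xd_orthonormal 0 s; rewrite dotC xd mul0r.
  - move=> s; rewrite /gauge_w -cross_base -frame_map_cross// frame_map_pt// frame_map_dir//.
    by rewrite dot_cross_r mul0r.
  - move=> s; rewrite /gauge_p /gauge (frame_map_pt (base_on 0)) dotC.
    by rewrite dot_cross_l mul0r.
  - exact: gauge_eE.
  - exact: gauge_fE.
  - exact: gauge_gE.
  - exact: gauge_clear.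
have sz_ge0 s : 0 <= sz s by exact: deviation_ge0.
have sz0 s : sz s = 0.
  apply/eqP; rewrite eq_le sz_ge0 andbT leNgt; apply/negP => szs.
  have csz : continuous sz by exact: deviation_gauge_continuous.
  (* Halving puts [v] strictly inside the gap while staying below [sz s], so it is attained between
     times 0 and [s]. *)
  pose v := Num.min (sz s) eps / 2.
  have m0 : 0 < Num.min (sz s) eps by rewrite lt_min szs.
  have [v0 vs ve] : [/\ 0 < v, v <= sz s & v < eps].
    have [ms me] : Num.min (sz s) eps <= sz s /\ Num.min (sz s) eps <= eps.
      by rewrite !ge_min !lexx orbT.
    by rewrite /v; split; lra.
  have sz00 : sz 0 = 0 := deviation_gauge0.
  have [c cv] : exists c, sz c = v.
    have [s0|s0] := leP 0 s.
      have [|c _ cv] := IVT s0 (continuous_subspaceT csz) (v := v); last by exists c.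
      by rewrite sz00 ge_min le_max (ltW v0) vs orbT.
    have [|c _ cv] := IVT (ltW s0) (continuous_subspaceT csz) (v := v); last by exists c.
    by rewrite sz00 ge_min le_max (ltW v0) vs orbT.
  by move: (epsP c); rewrite cv => /(_ ve) v00; rewrite v00 ltxx in v0.
move=> i6.
have : deviation1 gauge_u gauge_w gauge_p gauge_g gauge_e gauge_f i t = 0.
  by apply: le_anti; rewrite deviation1_ge0 andbT -(sz0 t) deviation1_le.
rewrite /deviation1 => sz1.
have [[u0 w0 p0] [g0 e0 f0]] : [/\ `|gauge_u i t| = 0, `|gauge_w i t| = 0 & `|gauge_p i t| = 0] /\
    [/\ `|gauge_g i t| = 0, `|gauge_e i t| = 0 & `|gauge_f i t| = 0].
  move: (normr_ge0 (gauge_u i t)) (normr_ge0 (gauge_w i t)) (normr_ge0 (gauge_p i t))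
    (normr_ge0 (gauge_g i t)) (normr_ge0 (gauge_e i t)) (normr_ge0 (gauge_f i t)) sz1.
  by move=> *; split; split; lra.
have {}u0 := normr0_eq0 u0; have {}w0 := normr0_eq0 w0; have {}p0 := normr0_eq0 p0.
have {}g0 := normr0_eq0 g0; have {}e0 := normr0_eq0 e0; have {}f0 := normr0_eq0 f0.
have dE : d i t = gauge t *m base_dir R i.
  rewrite [LHS](orthonormal_expand _ (gauge_on i t)) gauge_nor du dw de u0 w0 e0.
  by rewrite !mulr0 subr0 !scale0r scale1r addr0 add0r.
have nE : n i t = gauge t *m base_nor R i.
  rewrite [LHS](orthonormal_expand _ (gauge_on i t)) gauge_nor np ng nf p0 g0 f0.
  by rewrite !mulr0 subr0 oppr0 !scale0r scale1r !add0r.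
(* The tangency point is recovered as the cross product of direction and normal. *)
split=> //; rewrite -(orthonormal_cross_dn (xd_orthonormal i t)) -/(n i t) nE dE.
by rewrite frame_map_cross// -cross_base orthonormal_cross_dn.
Qed.

End RigidFrames.

(** * The initial configuration under both rotation conventions *)

Section Cylinders.
Variable R : realType.

Local Notation q3 := (Num.sqrt 3 : R).
Local Notation q5 := (Num.sqrt 5 : R).
Local Notation q11 := (Num.sqrt 11 : R).
Local Notation rm := (r_m R).

Lemma Pi_m_tube (j : 'I_6) :
  Pi_m R true j = tube ((1 + rm) *: base_pt R j) (base_dir R j) rm.
Proof. by rewrite /Pi_m C_mE. Qed.

Lemma skewE (x d y e : 'cV[R]_3) (k : R) :
  dot (k *: x - k *: y) (cross d e) = k * skew x d y e.
Proof. by rewrite /skew !dotE /cross !mxE /=; ring. Qed.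

Lemma r_m_gap (s w : R) :
  (4 * rm ^+ 2 * (1 - s) <= ((1 + rm) * w) ^+ 2) = (1 - s <= 11 / 12 * w ^+ 2).
Proof.
have e := r_mE R; have r0 := r_m_gt0 R.
have -> : ((1 + rm) * w) ^+ 2 = 4 * rm ^+ 2 * (11 / 12 * w ^+ 2).
  rewrite exprMn; have -> : (1 + rm) ^+ 2 = 44 / 12 * rm ^+ 2 by lra.
  by field.
by rewrite ler_pM2l// mulr_gt0// exprn_gt0.
Qed.

Lemma sqrt5_bounds : 2 < q5 < 9 / 4.
Proof.
apply/andP; split.
  by rewrite -[ltLHS]ger0_norm// -sqrtr_sqr ltr_sqrt//; lra.
by rewrite -[ltRHS]ger0_norm// -sqrtr_sqr ltr_sqrt//; lra.
Qed.

Lemma dot_base_dir i j :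
  dot (base_dir R i) (base_dir R j) = wdot (ldir (faxis (base_frame q5 i))) (ldir (faxis (base_frame q5 j))) / 192.
Proof.
have e3 := sqrt_nat R 3; rewrite /base_dir dotZl dotZr dot_emb.
by move: (wdot _ _) => w; move: q3 e3 => c e3; field: e3.
Qed.

Lemma base_skew i j : dot (base_dir R i) (base_dir R j) ^+ 2 +
    11 / 12 * skew (base_pt R i) (base_dir R i) (base_pt R j) (base_dir R j) ^+ 2 =
  clearance (faxis (base_frame q5 i)) (faxis (base_frame q5 j)) / level R.
Proof.
by rewrite /skew !cross_base -clear_emb [RHS]mulrC mulKf// level_neq0.
Qed.

Lemma contact_cases i j : (i < j < 6)%N ->
  (exists2 k, (k < 12)%N & contact k = (i, j)) \/
  (i, j) \in [:: (0, 4); (1, 5); (2, 3)]%N.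
Proof.
case/andP => ij j6; pose ks := [seq contact k | k <- iota 0 12].
suff : ((i, j) \in ks) || ((i, j) \in [:: (0, 4); (1, 5); (2, 3)]%N).
  case/orP => [/mapP[k]|]; last by right.
  by rewrite mem_iota => /andP[_ k12] ->; left; exists k.
by move: i j j6 ij => [|[|[|[|[|[|i]]]]]] [|[|[|[|[|[|j]]]]]].
Qed.

Lemma base_clear i j : (i < j < 6)%N ->
  level R <= clearance (faxis (base_frame q5 i)) (faxis (base_frame q5 j)).
Proof.
have e5 := sqrt_nat R 5.
case/contact_cases => [[k k12 kE]|].
  by rewrite -(base_contact e5 k12) /cclearance kE.
rewrite !inE => ij.
(* By symmetry the three pairs without contact share one value, which is 5 / 2 times [level]. *)
have -> : clearance (faxis (base_frame q5 i)) (faxis (base_frame q5 j)) = 720 ^+ 2 + 3 * 5 * 432 ^+ 2.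
  by case/or3P: ij => /eqP[-> ->]; rewrite /clearance /ldot /lmom /wdot /=;
    move: q5 e5 => s e5; ring: e5.
by rewrite levelE; lra.
Qed.

(** Excludes parallel axes, for which the gap inequality would read 0 <= 0 and give no
    disjointness. *)
Lemma dot_base_dir_lt1 i j : (i < j < 6)%N ->
  dot (base_dir R i) (base_dir R j) ^+ 2 < 1.
Proof.
move=> ij; have e5 : q5 * q5 = 5 by rewrite -expr2 sqrt_nat.
have /andP[b1 b2] := sqrt5_bounds.
suff /andP[h1 h2] : -1 < dot (base_dir R i) (base_dir R j) < 1.
  by rewrite -(ltr_pM2l (ltr0Sn R 0)); nra.
rewrite dot_base_dir; move: q5 e5 b1 b2 => s e5 b1 b2.
case/andP: ij => ij j6; move: i j j6 ij.
by move=> [|[|[|[|[|[|i]]]]]] [|[|[|[|[|[|j]]]]]] //= _ _; rewrite /wdot /=; apply/andP; split; lra.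
Qed.

Lemma Pi_m_touching : touching_collection (Pi_m R true).
Proof.
have r0 := r_m_gt0 R.
have dis (i j : 'I_6) : (i < j)%N -> Pi_m R true i `&` Pi_m R true j = set0.
  move=> ij; have ij6 : (i < j < 6)%N by rewrite ij ltn_ord.
  rewrite !Pi_m_tube; apply: gap_disjoint_tubes => //; rewrite ?base_orthonormal//.
    exact: dot_base_dir_lt1.
  rewrite skewE r_m_gap lerBlDl base_skew ler_pdivlMr ?mul1r ?base_clear//.
  exact: level_gt0.
split=> [j|i j|j].
- by rewrite Pi_m_tube; exact: open_tube.
- by rewrite neq_ltn => /orP[|] /dis// ; rewrite setIC.
- by rewrite Pi_m_tube; apply: touches_ball_tube => //; rewrite base_orthonormal.
Qed.

Lemma Pi_m_contact : has_contact (Pi_m R true).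
Proof.
have r0 := r_m_gt0 R.
exists (inord 0), (inord 1); split; first by rewrite -val_eqE /= !inordK.
rewrite !Pi_m_tube !inordK//; apply: gap_eq_set_dist => //; rewrite ?base_orthonormal//.
  exact: dot_base_dir_lt1.
have bc : clearance (faxis (base_frame q5 0)) (faxis (base_frame q5 1)) = level R :=
  base_contact (sqrt_nat R 5) (isT : (0 < 12)%N).
have := base_skew 0 1; rewrite bc divff ?level_neq0// => sw.
rewrite skewE [RHS]exprMn; have := r_mE R; move: sw.
move: (dot _ _ ^+ 2) (skew _ _ _ _ ^+ 2) => s w sw rE.
have -> : (1 + rm) ^+ 2 = 44 / 12 * rm ^+ 2 by lra.
by rewrite (_ : 1 - s = 11 / 12 * w); [field|lra].
Qed.

(** For A and D the gap inequality would bound 1 - s^2, about 0.87, by 11/12 of the squared [skew],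
    about 0.02. *)
Lemma Pi_m_ccw_overlap : ~ touching_collection (Pi_m R false).
Proof.
have r0 := r_m_gt0 R; have [e2 e3 e11] := And3 (sqrt_nat R 2) (sqrt_nat R 3) (sqrt_nat R 11).
have e5 := sqrt_nat R 5; have /andP[b1 b2] := sqrt5_bounds.
case=> _ /(_ (inord 0) (inord 3)) dis _.
have {}dis := dis (_ : inord 0 != inord 3); rewrite -val_eqE /= !inordK// in dis.
have {dis} := dis isT; rewrite /Pi_m !C_m_ccwE /cylinder /= => dis.
pose d1 := (q3 / 24) *: emb (Vec ((9 - 3 * q5) / 2) (- ((9 + q5) / 2)) 4).
pose d2 := (q3 / 24) *: emb (Vec 9 q5 4).
have s12 : dot d1 d2 = (43 - 9 * q5) / 64.
  rewrite /d1 /d2 dotZl dotZr dot_emb /wdot /=.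
  by move: q3 q5 e3 e5 => b c e3 e5; field: e3 e5.
have d11 : dot d1 d1 = 1.
  rewrite /d1 dotZl dotZr dot_emb /wdot /=.
  by move: q3 q5 e3 e5 => b c e3 e5; field: e3 e5.
have d22 : dot d2 d2 = 1.
  rewrite /d2 dotZl dotZr dot_emb /wdot /=.
  by move: q3 q5 e3 e5 => b c e3 e5; field: e3 e5.
have := disjoint_tubes_gap r0 d11 d22 dis.
rewrite skewE r_m_gap s12.
have -> : skew (base_pt R 0) d1 (base_pt R 3) d2 = q11 * (21 - 3 * q5) / 352.
  rewrite /skew /d1 /d2 /base_pt dotE /cross /emb.
  rewrite [X in _ + X]dotE !mxE /=.
  move: (Num.sqrt 2) q3 q5 q11 e2 e3 e5 e11 => a b c d e2 e3 e5 e11.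
  by field: e2 e3 e5 e11.
rewrite !expr_div_n !exprMn e11.
move: q5 e5 b1 b2 => s e5 b1 b2.
nra.
Qed.

End Cylinders.


(** * Rigidity *)
Section Rigidity.
Variable R : realType.
Local Notation rm := (r_m R).

(** Evaluating at |t| extends a curve on [0, +oo[ to the whole line, where [rigid_frames] is stated
    without restrictions on time. *)
Lemma within_comp_norm_continuous (U : topologicalType) (f : R -> U) :
  {within `[0, +oo[, continuous f} -> continuous (fun t : R => f (`|t| : R)).
Proof.
move=> /subspace_continuousP cf t W fW.
have t0 : `[0, +oo[%classic (`|t| : R) by rewrite /= in_itv /= normr_ge0.
have nc : continuous (fun s : R => `|s|) by apply: fct_norm_continuous => s.
have H : nbhs t (fun s : R => `[0, +oo[%classic (`|s| : R) -> W (f (`|s| : R))).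
  exact: nc t _ (cf _ t0 W fW).
rewrite -[X in X W]/(nbhs (fmap (fun s : R => f (`|s| : R)) (nbhs t))) /nbhs /=.
by apply: filterS H => s; apply; rewrite /= in_itv /= normr_ge0.
Qed.

Lemma entry_continuous (T : topologicalType) m n (f : T -> 'M[R]_(m, n)) i j :
  continuous f -> continuous (fun t => f t i j).
Proof.
move=> cf t; apply: (@continuous_comp _ _ _ f (fun M => M i j) t (cf t)).
exact: coord_continuous.
Qed.

Theorem Pi_m_rigid : rigid (Pi_m R true).
Proof.
move=> Pt [tc [A [b Ab]]] t0 t00.
have r0 := r_m_gt0 R; have r1 : 0 < 1 + rm by rewrite addr_gt0.
pose J (i : nat) : 'I_6 := inord i.
pose c (i : nat) (t : R) := A (J i) `|t| *m ((1 + rm) *: base_pt R (J i)) + b (J i) `|t|.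
pose d (i : nat) (t : R) := A (J i) `|t| *m base_dir R (J i).
(* A motion may slide a cylinder along its own axis, so [c] need not stay nearest to the origin.
   Projecting to the foot of the perpendicular removes the sliding, and contact with the ball makes
   [x] a unit vector. *)
pose x (i : nat) (t : R) := (1 + rm)^-1 *: (c i t - dot (c i t) (d i t) *: d i t).
have AO i (t : R) : orthogonal_mx (A (J i) `|t|) by have [_ _ AO _ _] := Ab (J i); exact: AO.
have d1 i t : dot (d i t) (d i t) = 1 by rewrite /d orthogonal_dot// base_orthonormal.
have xc i t : (1 + rm) *: x i t = c i t - dot (c i t) (d i t) *: d i t.
  by rewrite /x scalerA divff ?scale1r// gt_eqF.
have PtE i (t : R) : Pt `|t| (J i) = tube ((1 + rm) *: x i t) (d i t) rm.
  have [_ _ _ _ ->//] := Ab (J i).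
  by rewrite Pi_m_tube tube_motion// xc -scaleNr tube_shift.
have on i t : orthonormal (x i t) (d i t).
  have [_ _ touch] := tc _ (normr_ge0 t).
  have := touch (J i); rewrite PtE => /(touches_tube_dist r0 (d1 i t)).
  have xd : dot (x i t) (d i t) = 0.
    by rewrite /x dotZl dotDl dotNl dotZl d1 mulr1 subrr mulr0.
  rewrite dotZl xd mulr0 scale0r subr0 => /(congr1 (fun z => z ^+ 2)).
  rewrite enormE dotZl dotZr mulrA -expr2 => xx; split=> //.
  by apply: (@mulfI _ ((1 + rm) ^+ 2)); rewrite ?mulr1// gt_eqF// exprn_gt0.
have A0 i : A (J i) `|0 : R| = 1%:M /\ b (J i) `|0 : R| = 0.
  by rewrite normr0; have [_ _ _ A0 _] := Ab (J i).
have d0E i : (i < 6)%N -> d i 0 = base_dir R i.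
  by move=> i6; rewrite /d (A0 i).1 mul1mx /J inordK.
have x0E i : (i < 6)%N -> x i 0 = base_pt R i.
  move=> i6; rewrite /x d0E// /c (A0 i).1 (A0 i).2 mul1mx addr0 /J inordK//.
  by rewrite dotZl base_orthonormal mulr0 scale0r subr0 scalerA mulVf ?scale1r// gt_eqF.
have cA i v : vcontinuous (fun t : R => A (J i) `|t| *m v).
  have [cA _ _ _ _] := Ab (J i); have {}cA := within_comp_norm_continuous cA.
  move=> a; rewrite (_ : (fun _ => _) = fun t : R => \sum_k A (J i) `|t| a k * v k 0).
    apply: fct_sum_continuous => k; apply: fctM_continuous; last exact: cst_continuous.
    exact: entry_continuous cA.
  by apply/funext => t; rewrite mxE.
have cb i : vcontinuous (fun t : R => b (J i) `|t|).
  have [_ cb _ _ _] := Ab (J i); have {}cb := within_comp_norm_continuous cb.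
  by move=> a; exact: entry_continuous cb.
have cd i : vcontinuous (d i) by exact: cA.
have cc i : vcontinuous (c i) by exact: vcontinuousD (cA i _) (cb i).
have cx i : vcontinuous (x i).
  apply: vcontinuousZ; first exact: cst_continuous.
  rewrite (_ : (fun _ => _) = fun t => c i t + (- dot (c i t) (d i t)) *: d i t).
    apply: vcontinuousD => //; apply: vcontinuousZ => //; apply: fctN_continuous.
    exact: dot_continuous.
  by apply/funext => t; rewrite scaleNr.
have gap k t : (k < 12)%N -> let: (i, j) := contact k in
    1 - dot (d i t) (d j t) ^+ 2 <= 11 / 12 * skew (x i t) (d i t) (x j t) (d j t) ^+ 2.
  move=> k12; have : [/\ ((contact k).1 < 6)%N, ((contact k).2 < 6)%N &
      (contact k).1 != (contact k).2].
    by move: k k12; apply: ord12_ind.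
  case: (contact k) => i j [/= i6 j6 ij].
  have [_ dis _] := tc _ (normr_ge0 t).
  have := dis (J i) (J j); rewrite -val_eqE /= !inordK// => /(_ ij).
  rewrite !PtE => /(disjoint_tubes_gap r0 (d1 _ _) (d1 _ _)).
  by rewrite skewE r_m_gap.
have RF := rigid_frames on x0E d0E cx cd gap t0.
have base_on i : orthonormal (base_pt R i) (base_dir R i).
  by split; rewrite base_orthonormal.
exists (gauge x d t0); first exact: frame_map_SO3.
move=> j; have Jj : J j = j by rewrite /J inord_val.
have := PtE j t0; rewrite ger0_norm// Jj => ->.
have GO : orthogonal_mx (gauge x d t0) by exact: frame_map_orthogonal.
rewrite !RF// Pi_m_tube -[gauge x d t0 *m base_pt R j]/(gauge x d t0 *m base_pt R j).
rewrite scalemxAr -[_ *m _ in LHS]addr0 -tube_motion//.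
by apply: eq_imagel => p _; rewrite addr0.
Qed.

(** Rotations preserve distances, so a zero distance is still zero at time 1. *)
Lemma rigid_not_unlocked k (P : collection R k) : rigid P -> ~ can_be_unlocked P.
Proof.
move=> rP [Pt [def [i [j [_ d0 /(_ 1 ltr01)]]]]].
have [g [gO _] gE] := rP Pt def 1 ler01.
by rewrite !gE set_dist_motion// d0 ltxx.
Qed.

(** At time 0 a deformation is the collection itself, so an overlapping collection has none and is
    vacuously rigid. *)
Lemma deformation_touching k (P : collection R k) Pt :
  deformation P Pt -> touching_collection P.
Proof.
move=> [/(_ 0 (lexx 0)) tc [A [b Ab]]].
suff -> : P = Pt 0 by [].
apply/funext => j; have [_ _ _ [A0 b0] ->//] := Ab j.
by rewrite A0 b0; apply/seteqP; split=> [p Pp|_ [p Pp <-]]; [exists p|];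
  rewrite // mul1mx addr0.
Qed.

End Rigidity.

Theorem mainTheorem3 (R : realType) :
  touching_collection (Pi_m R true) /\ has_contact (Pi_m R true) /\
  (forall cw : bool,
    ~ can_be_unlocked (Pi_m R cw) /\ rigid (Pi_m R cw)).
Proof.
split; first exact: Pi_m_touching.
split; first exact: Pi_m_contact.
case; first by split; [exact/rigid_not_unlocked/Pi_m_rigid|exact: Pi_m_rigid].
have rigid_ccw : rigid (Pi_m R false).
  by move=> Pt /deformation_touching /Pi_m_ccw_overlap.
by split=> //; exact: rigid_not_unlocked.
Qed.
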